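(* (i) For every Brjuno number $x\in(0,\tfrac12)$, $$\Delta^-(x)=\sum_{i=0}^{\infty}(-1)^i\,\beta_{i-1}(x)\,\tilde f(\varepsilon_i x_i).$$ (ii) The series $\sum_{i\ge0}(-1)^i\beta_{i-1}(x)\tilde f(\varepsilon_ix_i)$ converges uniformly on $(0,\tfrac12)\setminus\mathbf{Q}$. (iii) For each integer $M\ge1$, let $\Delta^-_M(x)=\sum_{i=0}^{M}(-1)^i\beta_{i-1}(x)\tilde f(\varepsilon_ix_i)$ for irrational $x\in(0,\tfrac12)$. Then $\Delta^-_M$ is continuous on $(0,\tfrac12)\setminus\mathbf{Q}$ and has a limit (taken through irrationals) at every rational point of $(0,\tfrac12)$ of depth greater than $M$; at every rational $p/q\in(0,\tfrac12)$ in lowest terms of depth at most $M$, the one-sided limits of $\Delta^-_M$ through irrationals exist and satisfy $$\lim_{x\to(p/q)^+}\Delta^-_M(x)-\lim_{x\to(p/q)^-}\Delta^-_M(x)=\frac{2}{q}.$$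
   Context: Nearest-integer continued fraction: $A_{1/2}(y)=\bigl|\tfrac1y-\lfloor\tfrac1y+\tfrac12\rfloor\bigr|$ for $y\in(0,\tfrac12]$, mapping into $[0,\tfrac12]$. For irrational $x\in(0,\tfrac12)$ set $x_0=x$, $\varepsilon_0=1$, and for $i\ge1$: $a_i=\lfloor 1/x_{i-1}+\tfrac12\rfloor$, $\varepsilon_i=\operatorname{sgn}(1/x_{i-1}-a_i)\in\{\pm1\}$, $x_i=\varepsilon_i(1/x_{i-1}-a_i)=A_{1/2}(x_{i-1})\in(0,\tfrac12)$. Put $\beta_{-1}(x)=1$ and $\beta_i(x)=\prod_{k=0}^{i}\varepsilon_kx_k$. The depth of a rational $r\in(0,\tfrac12)$ is the least $i\ge1$ with $A_{1/2}^i(r)=0$. Let $A(y)=1/y-\lfloor1/y\rfloor$ (Gauss map). Define $w$ on irrationals $y\in(0,\tfrac12)$ by $w(y)=\frac y2\log\frac{1-y}{y}-\log(1-y)$, extended to all irrationals as an even $1$-periodic function. For irrational $x\in(0,\tfrac12)$ with $n=\lfloor1/x\rfloor$ let $\Phi(x)=x\log x+xA(x)\log(xA(x))+x\sum_{j=1}^{n-1}\log(1-jx)$ and $f(x)=-w(x)-xw(A(x))-\Phi(x)$; $\tilde f$ is the odd $1$-periodic extension of $f$ to $\mathbf{R}\setminus\mathbf{Q}$ ($\tilde f(x)=f(\{x\})$ if $\{x\}\in(0,\tfrac12)$, $\tilde f(x)=-f(1-\{x\})$ if $\{x\}\in(\tfrac12,1)$). Brjuno/Wilton/semi-Brjuno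 functions: for irrational $x$ with $y=\{x\}$, $A_0(y)=\lfloor1/y+1\rfloor-1/y$, $B(x)=\sum_{j\ge0}(\prod_{k<j}A^k(y))\log\frac1{A^j(y)}$, $B_0(x)=\sum_{j\ge0}(\prod_{k<j}A_0^k(y))\log\frac1{A_0^j(y)}$, $W(x)=\sum_{j\ge0}(-1)^j(\prod_{k<j}A^k(y))\log\frac1{A^j(y)}$. $x$ is Brjuno if $B(x)<\infty$ (then $B_0(\pm x)<\infty$ and $W(\pm x)$ converge). For Brjuno $x$: $\Delta^-(x)=\tfrac12(W(x)-W(-x))-(B_0(x)-B_0(-x))$. Known facts usable here: $w=W^+$ (even part of $W$), and for Brjuno $x\in(0,\tfrac12)$ one has $\Phi(x)=xB_0(A(x))-B_0(1-x)$; $\Delta^-$ is odd and $1$-periodic and satisfies $\Delta^-(x)=f(x)-x\Delta^-(A(x))$ for Brjuno $x\in(0,\tfrac12)$. *)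

(* Defs.v *)
From Stdlib Require Import Reals ZArith.
From Coquelicot Require Import Coquelicot.
Open Scope R_scope.

Definition floorZ (x : R) : Z := Int_part x.
Definition fracR (x : R) : R := x - IZR (floorZ x).

Definition rationalR (x : R) : Prop :=
  exists p q : Z, q <> 0%Z /\ x = IZR p / IZR q.
Definition irrationalR (x : R) : Prop := ~ rationalR x.

Fixpoint sumR (n : nat) (g : nat -> R) : R :=
  match n with O => 0 | S m => sumR m g + g m end.
Fixpoint prodR (n : nat) (g : nat -> R) : R :=
  match n with O => 1 | S m => prodR m g * g m end.

Definition gaussA (y : R) : R := / y - IZR (floorZ (/ y)).
Definition gaussA0 (y : R) : R := IZR (floorZ (/ y + 1)) - / y.
Definition A_half (y : R) : R := Rabs (/ y - IZR (floorZ (/ y + / 2))).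

Fixpoint nicf_x (x : R) (i : nat) : R :=
  match i with O => x | S k => A_half (nicf_x x k) end.
Definition sgnR (r : R) : R := if Rlt_dec 0 r then 1 else -1.
Definition nicf_a (x : R) (i : nat) : R :=  (* a_{i+1} *)
  IZR (floorZ (/ nicf_x x i + / 2)).
Definition nicf_eps (x : R) (i : nat) : R :=
  match i with
  | O => 1
  | S k => sgnR (/ nicf_x x k - nicf_a x k)
  end.
(** beta_prev x i = beta_{i-1}(x) = prod_{k=0}^{i-1} eps_k x_k ; beta_{-1} = 1 *)
Definition beta_prev (x : R) (i : nat) : R :=
  prodR i (fun k => nicf_eps x k * nicf_x x k).

Definition is_depth (r : R) (d : nat) : Prop :=
  (1 <= d)%nat /\ nicf_x r d = 0 /\
  (forall i : nat, (1 <= i)%nat -> (i < d)%nat -> nicf_x r i <> 0).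

Definition termB (y : R) (j : nat) : R :=
  prodR j (fun k => Nat.iter k gaussA y) * ln (/ Nat.iter j gaussA y).
Definition termB0 (y : R) (j : nat) : R :=
  prodR j (fun k => Nat.iter k gaussA0 y) * ln (/ Nat.iter j gaussA0 y).
Definition termW (y : R) (j : nat) : R :=
  (-1) ^ j * termB y j.

Definition BrjunoB0 (x : R) : R := Series (termB0 (fracR x)).
Definition WiltonW (x : R) : R := Series (termW (fracR x)).

Definition Brjuno (x : R) : Prop :=
  irrationalR x /\ ex_series (termB (fracR x)).

Definition Delta_minus (x : R) : R :=
  / 2 * (WiltonW x - WiltonW (- x)) - (BrjunoB0 x - BrjunoB0 (- x)).

Definition w0 (y : R) : R := y / 2 * ln ((1 - y) / y) - ln (1 - y).
Definition w (x : R) : R :=   (* even 1-periodic extension of w0 *)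
  let y := fracR x in if Rlt_dec y (/ 2) then w0 y else w0 (1 - y).

Definition Phi (x : R) : R :=
  let n := Z.to_nat (floorZ (/ x)) in
  x * ln x + x * gaussA x * ln (x * gaussA x)
  + x * sumR (n - 1) (fun j => ln (1 - INR (S j) * x)).

Definition f (x : R) : R := - w x - x * w (gaussA x) - Phi x.

Definition ftilde (x : R) : R :=   (* odd 1-periodic extension of f *)
  let y := fracR x in if Rlt_dec y (/ 2) then f y else - f (1 - y).

Definition Dterm (x : R) (i : nat) : R :=
  (-1) ^ i * beta_prev x i * ftilde (nicf_eps x i * nicf_x x i).
Definition DeltaM (M : nat) (x : R) : R := sum_f_R0 (Dterm x) M.

Definition in_dom (y : R) : Prop := 0 < y < / 2 /\ irrationalR y.

(* Main.v *)
Require Import Defs.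
From Stdlib Require Import Reals ZArith Lra Lia.
From Coquelicot Require Import Coquelicot.
Open Scope R_scope.

(** Extend [DeltaM M] to an odd 1-periodic function [E_M].  Since [eps_1 x_1] differs from
    [1/x] by an integer, the signs disappear and [E_(M+1) x = f x - x E_M (1/x)] on
    (0,1/2).  The function [f] is continuous on (0,1/2], vanishes at 1/2 and tends to 1
    at 0 (a Riemann sum for the integral of [ln (1 - t)]), so [E_M] tends to 1 at 0+
    for all [M].  Jumps then follow by induction on [M]: a jump 2/p of [E_M] at q/p
    becomes (p/q)(2/p) = 2/q at p/q; oddness gives the jump 2 at 0 and, together with
    the limit of [E_M] at 2+, the jump 1 at 1/2.

    [Delta_minus] satisfies the same recursion, so its distance to [DeltaM M] is
    contracted by [x_k] at each step.  It is bounded by a constant plus a multiple of the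
    Brjuno function, and the products of the [x_k] are products of Gauss iterates, so the
    distance is at most [O(2^-M)] plus a multiple of a tail of the Brjuno series. *)

(** * Nearest integers and odd periodic extensions *)

(** Inversion throws the points of (0,1/2) out of that interval. The inductions therefore run over
    all irrationals, or over all reduced fractions, and reduction modulo sign and integers leads
    back to [0,1/2]; the endpoints 0 and 1/2 become the base points of the jump law.

    The nearest-integer orbit accelerates the Gauss orbit: if A(x) > 1/2, then x_1 = 1 - A(x) and
    A(A(x)) = x_1 / (1 - x_1), so A(x) A(A(x)) = x_1 and one step replaces two. Hence the weights in
    the error match those of the Brjuno series. A uniform bound on the error is out of reach by this
    route, since the Brjuno function is unbounded.

    The Brjuno condition only gives convergence of B, so summability of the series of B_0 is
    obtained from bounds on its partial sums. The orbit of 1 - x under A_0 joins that of A(x) after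
    floor(1/x) steps, and summation by parts along this excursion produces [Phi]. Done once for
    partial sums and once for full sums, this computation gives both the bound on B_0 and the
    functional equation. *)

Lemma floorZ_bounds (z : R) : IZR (floorZ z) <= z < IZR (floorZ z) + 1.
Proof. unfold floorZ; destruct (base_Int_part z); lra. Qed.

Lemma floorZ_unique (z : R) (k : Z) : IZR k <= z < IZR k + 1 -> floorZ z = k.
Proof. intros H; unfold floorZ; symmetry; apply Int_part_spec; lra. Qed.

Lemma rationalR_IZR (k : Z) : rationalR (IZR k).
Proof. exists k, 1%Z; split; [lia | field]. Qed.

Lemma rationalR_opp (x : R) : rationalR x -> rationalR (- x).
Proof.
intros (p & q & Hq & ->); exists (- p)%Z, q; split; auto.
rewrite opp_IZR; unfold Rdiv; ring.
Qed.

Lemma rationalR_plus_IZR (x : R) (k : Z) : rationalR x -> rationalR (x + IZR k).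
Proof.
intros (p & q & Hq & ->); exists (p + k * q)%Z, q; split; auto.
rewrite plus_IZR, mult_IZR; field; apply not_0_IZR; auto.
Qed.

Lemma rationalR_inv (x : R) : rationalR x -> rationalR (/ x).
Proof.
intros (p & q & Hq & ->); destruct (Z.eq_dec p 0) as [-> | Hp].
- replace (/ (0 / IZR q)) with (IZR 0) by (unfold Rdiv; rewrite Rmult_0_l, Rinv_0; auto).
  apply rationalR_IZR.
- exists q, p; split; auto; field; split; apply not_0_IZR; auto.
Qed.

Lemma irrationalR_neq_IZR (x : R) (k : Z) : irrationalR x -> x <> IZR k.
Proof. intros H ->; apply H, rationalR_IZR. Qed.

Lemma irrationalR_neq_0 (x : R) : irrationalR x -> x <> 0.
Proof. apply irrationalR_neq_IZR. Qed.

Lemma irrationalR_neq_half (x : R) : irrationalR x -> x <> / 2.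
Proof. intros H ->; apply H; exists 1%Z, 2%Z; split; [lia | field]. Qed.

Lemma irrationalR_opp (x : R) : irrationalR x -> irrationalR (- x).
Proof. intros H Hx; apply H; rewrite <- (Ropp_involutive x); apply rationalR_opp; auto. Qed.

Lemma irrationalR_plus_IZR (x : R) (k : Z) : irrationalR x -> irrationalR (x + IZR k).
Proof.
intros H Hx; apply H; replace x with ((x + IZR k) + IZR (- k)).
- apply rationalR_plus_IZR; auto.
- rewrite opp_IZR; ring.
Qed.

Lemma irrationalR_minus_IZR (x : R) (k : Z) : irrationalR x -> irrationalR (x - IZR k).
Proof.
intros H; replace (x - IZR k) with (x + IZR (- k)) by (rewrite opp_IZR; ring).
apply irrationalR_plus_IZR; auto.
Qed.

Lemma irrationalR_1_minus (x : R) : irrationalR x -> irrationalR (1 - x).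
Proof.
intros H; replace (1 - x) with (- x + IZR 1) by ring.
apply irrationalR_plus_IZR, irrationalR_opp; auto.
Qed.

Lemma irrationalR_inv (x : R) : irrationalR x -> irrationalR (/ x).
Proof. intros H Hx; apply H; rewrite <- (Rinv_inv x); apply rationalR_inv; auto. Qed.

Definition nintZ (z : R) : Z := floorZ (z + / 2).
Definition normZ (z : R) : R := Rabs (z - IZR (nintZ z)).
Definition sgnZ (z : R) : R := sgnR (z - IZR (nintZ z)).

(** Written with the nearest integer, half-integers being rounded up, so that [sgnZ (/ x)] and
    [normZ (/ x)] are by definition eps_1 and x_1. At integers and half-integers [sgnZ] is -1, so
    oddness is only guaranteed away from them. *)
Definition oddper (g : R -> R) (z : R) : R := sgnZ z * g (normZ z).

Lemma nintZ_bounds (z : R) : - / 2 <= z - IZR (nintZ z) < / 2.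
Proof. unfold nintZ; generalize (floorZ_bounds (z + / 2)); lra. Qed.

Lemma nintZ_unique (z : R) (k : Z) : - / 2 <= z - IZR k < / 2 -> nintZ z = k.
Proof. intros H; apply floorZ_unique; lra. Qed.

Lemma normZ_bounds (z : R) : 0 <= normZ z <= / 2.
Proof.
unfold normZ; generalize (nintZ_bounds z); intros H.
split; [apply Rabs_pos | apply Rabs_le; lra].
Qed.

Lemma normZ_le_dist (z : R) (k : Z) : normZ z <= Rabs (z - IZR k).
Proof.
destruct (Z.eq_dec k (nintZ z)) as [-> | H]; [apply Rle_refl |].
apply Rle_trans with (/ 2); [apply normZ_bounds |].
generalize (nintZ_bounds z); intros Hz.
destruct (Z.le_gt_cases k (nintZ z - 1)) as [Hk | Hk].
- apply IZR_le in Hk; rewrite minus_IZR in Hk.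
  eapply Rle_trans; [| apply Rle_abs]; lra.
- assert (Hk' : (nintZ z + 1 <= k)%Z) by lia.
  apply IZR_le in Hk'; rewrite plus_IZR in Hk'.
  rewrite <- Rabs_Ropp; eapply Rle_trans; [| apply Rle_abs]; lra.
Qed.

Lemma normZ_lipschitz (a b : R) : Rabs (normZ a - normZ b) <= Rabs (a - b).
Proof.
assert (H : forall a b, normZ a - normZ b <= Rabs (a - b)).
{ clear; intros a b; generalize (normZ_le_dist a (nintZ b)); unfold normZ at 3; intros H.
  generalize (Rabs_triang (a - b) (b - IZR (nintZ b))).
  replace (a - b + (b - IZR (nintZ b))) with (a - IZR (nintZ b)) by ring; lra. }
apply Rabs_le; split; [| apply H].
generalize (H b a); rewrite Rabs_minus_sym; lra.
Qed.

Lemma normZ_small (z : R) : 0 <= z <= / 2 -> normZ z = z.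
Proof.
intros H; destruct (Req_dec z (/ 2)) as [-> | Hz].
- unfold normZ; rewrite (nintZ_unique _ 1) by lra.
  rewrite Rabs_left; lra.
- unfold normZ; rewrite (nintZ_unique _ 0) by lra.
  rewrite Rabs_pos_eq; lra.
Qed.

Lemma sgnZ_small (z : R) : 0 < z < / 2 -> sgnZ z = 1.
Proof.
intros H; unfold sgnZ, sgnR; rewrite (nintZ_unique _ 0) by lra.
destruct Rlt_dec; lra.
Qed.

Lemma nintZ_plus_IZR (z : R) (k : Z) : nintZ (z + IZR k) = (nintZ z + k)%Z.
Proof. apply nintZ_unique; rewrite plus_IZR; generalize (nintZ_bounds z); lra. Qed.

Lemma normZ_plus_IZR (z : R) (k : Z) : normZ (z + IZR k) = normZ z.
Proof. unfold normZ; rewrite nintZ_plus_IZR, plus_IZR; f_equal; ring. Qed.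

Lemma sgnZ_plus_IZR (z : R) (k : Z) : sgnZ (z + IZR k) = sgnZ z.
Proof. unfold sgnZ; rewrite nintZ_plus_IZR, plus_IZR; f_equal; ring. Qed.

Lemma normZ_opp (z : R) : normZ (- z) = normZ z.
Proof.
assert (H : forall z, normZ (- z) <= normZ z).
{ clear; intros z; eapply Rle_trans; [apply (normZ_le_dist (- z) (- nintZ z)) |].
  unfold normZ; rewrite opp_IZR, <- (Rabs_Ropp (z - _)); apply Req_le; f_equal; ring. }
apply Rle_antisym; auto.
generalize (H (- z)); rewrite Ropp_involutive; auto.
Qed.

Lemma nint_dist_irrational (z : R) : irrationalR z ->
  irrationalR (z - IZR (nintZ z)).
Proof. apply irrationalR_minus_IZR. Qed.

Lemma sgnZ_opp (z : R) : irrationalR z -> sgnZ (- z) = - sgnZ z.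
Proof.
intros Hz; generalize (nintZ_bounds z) (irrationalR_neq_0 _ (nint_dist_irrational _ Hz))
  (irrationalR_neq_half _ (irrationalR_opp _ (nint_dist_irrational _ Hz))); intros H1 H2 H3.
unfold sgnZ, sgnR; rewrite (nintZ_unique (- z) (- nintZ z)) by (rewrite opp_IZR; lra).
rewrite opp_IZR; repeat destruct Rlt_dec; lra.
Qed.

Lemma Rabs_sgnZ (z : R) : Rabs (sgnZ z) = 1.
Proof.
unfold sgnZ, sgnR; destruct Rlt_dec; [apply Rabs_R1 | rewrite Rabs_left; lra].
Qed.

Lemma normZ_irrational (z : R) : irrationalR z -> irrationalR (normZ z).
Proof.
intros Hz; apply nint_dist_irrational in Hz.
unfold normZ, Rabs; destruct Rcase_abs; auto; apply irrationalR_opp; auto.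
Qed.

Lemma in_dom_normZ_irrational (z : R) : irrationalR (normZ z) -> in_dom (normZ z).
Proof.
intros H; split; auto.
generalize (irrationalR_neq_0 _ H) (irrationalR_neq_half _ H) (normZ_bounds z); lra.
Qed.

Lemma normZ_in_dom (z : R) : irrationalR z -> in_dom (normZ z).
Proof. intros Hz; apply in_dom_normZ_irrational, normZ_irrational; auto. Qed.

Lemma oddper_plus_IZR (g : R -> R) (z : R) (k : Z) : oddper g (z + IZR k) = oddper g z.
Proof. unfold oddper; rewrite sgnZ_plus_IZR, normZ_plus_IZR; auto. Qed.

Lemma oddper_opp (g : R -> R) (z : R) : irrationalR z -> oddper g (- z) = - oddper g z.
Proof. intros Hz; unfold oddper; rewrite sgnZ_opp, normZ_opp; auto; ring. Qed.

Lemma oddper_in_dom (g : R -> R) (z : R) : in_dom z -> oddper g z = g z.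
Proof.
intros [Hz _]; unfold oddper; rewrite sgnZ_small, normZ_small by lra; ring.
Qed.

Lemma fracR_bounds (z : R) : 0 <= fracR z < 1.
Proof. unfold fracR; generalize (floorZ_bounds z); lra. Qed.

Lemma fracR_plus_floor (z : R) : z = fracR z + IZR (floorZ z).
Proof. unfold fracR; ring. Qed.

Lemma normZ_fracR (z : R) : normZ (fracR z) = normZ z.
Proof. rewrite (fracR_plus_floor z) at 2; rewrite normZ_plus_IZR; auto. Qed.

Lemma normZ_refl (z : R) (k : Z) : normZ (IZR k - z) = normZ z.
Proof.
rewrite <- normZ_opp; replace (- (IZR k - z)) with (z + IZR (- k)).
- apply normZ_plus_IZR.
- rewrite opp_IZR; ring.
Qed.

Lemma w_normZ (z : R) : w z = w0 (normZ z).
Proof.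
unfold w; rewrite <- normZ_fracR.
generalize (fracR_bounds z); intros H; destruct Rlt_dec.
- rewrite normZ_small; auto; lra.
- rewrite <- (normZ_refl _ 1), normZ_small; auto; lra.
Qed.

Lemma fracR_irrational (z : R) : irrationalR z -> irrationalR (fracR z).
Proof. apply irrationalR_minus_IZR. Qed.

Lemma oddper_fracR (g : R -> R) (z : R) : irrationalR z ->
  oddper g z = if Rlt_dec (fracR z) (/ 2) then g (fracR z) else - g (1 - fracR z).
Proof.
intros Hz; rewrite (fracR_plus_floor z) at 1; rewrite oddper_plus_IZR.
apply fracR_irrational in Hz; generalize (fracR_bounds z); set (y := fracR z) in *.
generalize (irrationalR_neq_half _ Hz) (irrationalR_neq_0 _ Hz); intros H1 H2 H.
destruct Rlt_dec.
- apply oddper_in_dom; split; auto; lra.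
- assert (Hy : in_dom (1 - y)) by (split; [lra | apply irrationalR_1_minus; auto]).
  replace y with (- (1 - y) + IZR 1) by ring.
  rewrite oddper_plus_IZR, oddper_opp, oddper_in_dom by (auto; apply Hy).
  f_equal; f_equal; ring.
Qed.

Lemma ftilde_oddper (z : R) : irrationalR z -> ftilde z = oddper Defs.f z.
Proof. intros Hz; rewrite oddper_fracR; auto. Qed.

(** * Shift of the nearest-integer expansion and recursion for the partial sums *)

Lemma A_half_normZ (x : R) : A_half x = normZ (/ x).
Proof. reflexivity. Qed.

Lemma A_half_in_dom (x : R) : irrationalR x -> in_dom (A_half x).
Proof. intros Hx; rewrite A_half_normZ; apply normZ_in_dom, irrationalR_inv; auto. Qed.

Lemma nicf_x_S (x : R) (i : nat) : nicf_x x (S i) = nicf_x (A_half x) i.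
Proof.
induction i; auto; change (A_half (nicf_x x (S i)) = A_half (nicf_x (A_half x) i)).
rewrite IHi; auto.
Qed.

Lemma nicf_eps_1 (x : R) : nicf_eps x 1 = sgnZ (/ x).
Proof. reflexivity. Qed.

Lemma nicf_eps_S (x : R) (i : nat) : nicf_eps x (S (S i)) = nicf_eps (A_half x) (S i).
Proof. unfold nicf_eps, nicf_a; rewrite nicf_x_S; auto. Qed.

Lemma prodR_S (n : nat) (g : nat -> R) : prodR (S n) g = g O * prodR n (fun k => g (S k)).
Proof.
induction n; [simpl; ring |].
change (prodR (S n) g * g (S n) = g O * (prodR n (fun k => g (S k)) * g (S n))).
rewrite IHn; ring.
Qed.

Lemma prodR_ext (n : nat) (g h : nat -> R) : (forall k, g k = h k) -> prodR n g = prodR n h.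
Proof. intros H; induction n; simpl; auto; rewrite IHn, H; auto. Qed.

Lemma Dterm_0 (x : R) : in_dom x -> Dterm x 0 = Defs.f x.
Proof.
intros Hx; unfold Dterm, beta_prev; simpl.
rewrite !Rmult_1_l, ftilde_oddper, oddper_in_dom; auto; apply Hx.
Qed.

(** The expansion of x_1 restarts with sign 1 where that of x has eps_1; this lost sign is the
    factor [sgnZ (/ x)]. It enters the product only once x_1 does, hence the index [S (S i)]. *)
Lemma beta_prev_S (x : R) (i : nat) :
  beta_prev x (S (S i)) = x * sgnZ (/ x) * beta_prev (A_half x) (S i).
Proof.
unfold beta_prev.
rewrite (prodR_S (S i)), (prodR_S i), (prodR_S i).
rewrite (prodR_ext i _ (fun k => nicf_eps (A_half x) (S k) * nicf_x (A_half x) (S k))).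
- rewrite nicf_eps_1, nicf_x_S; simpl; ring.
- intros k; rewrite nicf_eps_S, nicf_x_S; auto.
Qed.

(** The sign eps_1 sits in the argument of [ftilde] when [i] is 0 and in [beta_prev] otherwise;
    oddness of [ftilde] extracts it in the first case. *)
Lemma Dterm_S (x : R) (i : nat) : in_dom x ->
  Dterm x (S i) = - x * sgnZ (/ x) * Dterm (A_half x) i.
Proof.
intros Hx; generalize (A_half_in_dom x (proj2 Hx)); intros HA.
destruct i.
- rewrite Dterm_0 by auto; unfold Dterm, beta_prev; simpl prodR.
  rewrite nicf_eps_1, nicf_x_S; simpl nicf_x; simpl nicf_eps.
  replace (ftilde (sgnZ (/ x) * A_half x)) with (sgnZ (/ x) * Defs.f (A_half x)); [ring |].
  rewrite <- (oddper_in_dom Defs.f) by auto; unfold sgnZ, sgnR; destruct Rlt_dec.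
  + rewrite !Rmult_1_l, ftilde_oddper; auto; apply HA.
  + replace (-1 * A_half x) with (- A_half x) by ring.
    rewrite ftilde_oddper, oddper_opp; try apply irrationalR_opp; try apply HA; ring.
- unfold Dterm; rewrite beta_prev_S, nicf_eps_S, nicf_x_S; simpl pow; ring.
Qed.

Lemma DeltaM_0 (x : R) : in_dom x -> DeltaM 0 x = Defs.f x.
Proof. apply Dterm_0. Qed.

Lemma DeltaM_S (M : nat) (x : R) : in_dom x ->
  DeltaM (S M) x = Defs.f x - x * oddper (DeltaM M) (/ x).
Proof.
intros Hx; unfold DeltaM, oddper; rewrite decomp_sum by lia.
rewrite Dterm_0 by auto; simpl pred.
rewrite (sum_eq _ (fun i => Dterm (A_half x) i * (- x * sgnZ (/ x)))).
- rewrite <- scal_sum, <- A_half_normZ; ring.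
- intros i _; rewrite Dterm_S by auto; ring.
Qed.

(** * Continuity and behavior at 0 of [f] *)

Lemma ln_le_minus_1 (t : R) : 0 < t -> ln t <= t - 1.
Proof. intros H; generalize (exp_ineq1_le (ln t)); rewrite exp_ln; lra. Qed.

Lemma ln_ge_1_minus_inv (t : R) : 0 < t -> 1 - / t <= ln t.
Proof.
intros H; generalize (ln_le_minus_1 (/ t) (Rinv_0_lt_compat _ H)); rewrite ln_Rinv; lra.
Qed.

Lemma ln_nonpos (t : R) : t <= 0 -> ln t = 0.
Proof. intros H; unfold ln; destruct Rlt_dec; auto; exfalso; lra. Qed.

Lemma ln_le_0 (t : R) : t <= 1 -> ln t <= 0.
Proof.
intros H; destruct (Rlt_le_dec 0 t) as [H0 | H0].
- generalize (ln_le_minus_1 t H0); lra.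
- rewrite ln_nonpos; lra.
Qed.

Lemma xlnx_ge (t : R) : 0 <= t -> t - 1 <= t * ln t.
Proof.
intros [H | <-]; [| lra].
replace (t - 1) with (t * (1 - / t)) by (field; lra).
apply Rmult_le_compat_l; [lra | apply ln_ge_1_minus_inv; auto].
Qed.

Lemma xlnx_le_0 (t : R) : 0 <= t <= 1 -> t * ln t <= 0.
Proof. intros [H0 H1]; generalize (ln_le_0 t H1); nra. Qed.

(** With s = sqrt t, t ln t = 2 s (s ln s) and s ln s >= s - 1 >= -1. This explicit modulus serves
    both for continuity at 0 and for the rate of [Phi] near 0. *)
Lemma xlnx_ge_sqrt (t : R) : 0 <= t <= 1 -> - 2 * sqrt t <= t * ln t.
Proof.
intros [[H | <-] H1]; [| rewrite sqrt_0; lra].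
generalize (sqrt_lt_R0 t H) (sqrt_sqrt t ltac:(lra)); set (s := sqrt t); intros Hs Hst.
rewrite <- Hst, ln_mult by auto.
generalize (xlnx_ge s ltac:(lra)); nra.
Qed.

Lemma sqrt_lt_eps (c eps t : R) : 0 < c -> 0 < eps -> 0 <= t < (eps / c) ^ 2 -> c * sqrt t < eps.
Proof.
intros Hc He [Ht Ht'].
assert (0 < eps / c) by (apply Rdiv_lt_0_compat; auto).
generalize (sqrt_lt_1_alt _ _ (conj Ht Ht')); clear Ht'; intros Ht'; rewrite sqrt_pow2 in Ht' by lra.
apply Rmult_lt_compat_l with (r := c) in Ht'; auto.
replace (c * (eps / c)) with eps in Ht' by (field; lra); auto.
Qed.

(* Since [ln] is [0] on nonpositive numbers, continuity also holds at [0]. *)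
Lemma continuous_xlnx (t : R) : continuous (fun t => t * ln t) t.
Proof.
destruct (Rtotal_order t 0) as [H | [-> | H]].
- apply continuous_ext_loc with (fun _ => 0); [| apply continuous_const].
  assert (He : 0 < - t) by lra.
  exists (mkposreal _ He); intros y Hy.
  change (Rabs (y - t) < - t) in Hy; apply Rabs_def2 in Hy.
  rewrite ln_nonpos; lra.
- apply filterlim_locally; intros [eps Heps]; simpl.
  assert (0 < eps / 2) by lra.
  assert (Hd : 0 < Rmin 1 ((eps / 2) ^ 2)) by (apply Rmin_pos; [lra | nra]).
  exists (mkposreal _ Hd); intros x Hx.
  change (Rabs (x - 0) < Rmin 1 ((eps / 2) ^ 2)) in Hx.
  change (Rabs (x * ln x - 0 * ln 0) < eps).
  rewrite Rmult_0_l, Rminus_0_r; rewrite Rminus_0_r in Hx.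
  generalize (Rmin_l 1 ((eps / 2) ^ 2)) (Rmin_r 1 ((eps / 2) ^ 2)); intros.
  destruct (Rle_lt_dec x 0) as [Hx0 | Hx0].
  + rewrite ln_nonpos, Rmult_0_r, Rabs_R0; lra.
  + rewrite (Rabs_pos_eq x) in Hx by lra.
    assert (Hx1 : 0 <= x <= 1) by lra.
    generalize (xlnx_ge_sqrt x Hx1) (xlnx_le_0 x Hx1) (sqrt_lt_eps 2 eps x ltac:(lra) Heps); intros.
    rewrite Rabs_left1 by auto; simpl in *; lra.
- apply (ex_derive_continuous (fun t => t * ln t)); auto_derive; auto.
Qed.

(** Removes the quotient (1 - y)/y, so that the formula is visibly continuous up to y = 0. *)
Lemma w0_eq (y : R) : 0 <= y < 1 -> w0 y = - (/ 2) * (y * ln y) + (y / 2 - 1) * ln (1 - y).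
Proof.
intros [[H | <-] H1]; unfold w0.
- rewrite ln_div by lra; field.
- replace (1 - 0) with 1 by ring; rewrite ln_1; field.
Qed.

Lemma w0_bounds (y : R) : 0 <= y <= / 2 -> 0 <= w0 y <= 2.
Proof.
intros H; rewrite w0_eq by lra.
generalize (xlnx_le_0 y ltac:(lra)) (xlnx_ge y ltac:(lra)) (ln_le_0 (1 - y) ltac:(lra))
  (ln_ge_1_minus_inv (1 - y) ltac:(lra)); intros.
assert (/ (1 - y) <= 2).
{ rewrite <- (Rinv_inv 2); apply Rinv_le_contravar; lra. }
assert (-1 <= ln (1 - y)) by lra.
split; nra.
Qed.

Lemma w_bounds (z : R) : 0 <= w z <= 2.
Proof. rewrite w_normZ; apply w0_bounds, normZ_bounds. Qed.

Lemma w_0 : w 0 = 0.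
Proof. rewrite w_normZ, normZ_small, w0_eq by lra; rewrite Rminus_0_r, ln_1; lra. Qed.

Lemma continuous_normZ (z : R) : continuous normZ z.
Proof.
intros P [d Hd]; exists d; intros y Hy; apply Hd.
eapply Rle_lt_trans; [apply normZ_lipschitz | apply Hy].
Qed.

Lemma continuous_w (z : R) : continuous w z.
Proof.
set (g := fun y => - (/ 2) * (y * ln y) + (y / 2 - 1) * ln (1 - y)).
apply continuous_ext with (fun z => g (normZ z)).
{ intros y; unfold g; rewrite w_normZ, w0_eq; auto; generalize (normZ_bounds y); lra. }
apply (continuous_comp normZ g); [apply continuous_normZ | unfold g].
generalize (normZ_bounds z); set (y := normZ z); intros Hy.
apply (continuous_plus (fun y => - (/ 2) * (y * ln y)) (fun y => (y / 2 - 1) * ln (1 - y))).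
- apply (continuous_mult (fun _ => - (/ 2)) (fun y => y * ln y));
    [apply continuous_const | apply continuous_xlnx].
- apply (ex_derive_continuous (fun y => (y / 2 - 1) * ln (1 - y))); auto_derive; lra.
Qed.

(** * Continuity and size of [Phi] *)

Lemma sumR_scal (n : nat) (c : R) (g : nat -> R) : c * sumR n g = sumR n (fun j => c * g j).
Proof. induction n; simpl; [ring | rewrite <- IHn; ring]. Qed.

Lemma sumR_ext (n : nat) (g h : nat -> R) :
  (forall j, (j < n)%nat -> g j = h j) -> sumR n g = sumR n h.
Proof. induction n; simpl; intros H; auto; rewrite IHn, (H n); auto. Qed.

Lemma sumR_telescope (n : nat) (g : nat -> R) : sumR n (fun j => g (S j) - g j) = g n - g O.
Proof. induction n; simpl; [ring | rewrite IHn; ring]. Qed.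

Lemma sumR_le (n : nat) (g h : nat -> R) :
  (forall j, (j < n)%nat -> g j <= h j) -> sumR n g <= sumR n h.
Proof.
induction n; simpl; intros H; [lra |].
apply Rplus_le_compat; auto.
Qed.

Lemma continuous_sumR (n : nat) (g : nat -> R -> R) (x : R) :
  (forall j, continuous (g j) x) -> continuous (fun x => sumR n (fun j => g j x)) x.
Proof.
intros H; induction n; simpl; [apply continuous_const |].
apply (continuous_plus (fun x => sumR n (fun j => g j x)) (g n)); auto.
Qed.

(** With n = floor(1/x), x A(x) is the term j = n of the progression 1 - jx, so the second summand
    of [Phi] continues its logarithmic sum. *)
Lemma floor_inv_nat (x : R) : 0 < x < 1 -> exists m : nat,
  Z.to_nat (floorZ (/ x)) = S m /\ x * gaussA x = 1 - INR (S m) * x /\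
  0 <= 1 - INR (S m) * x < x.
Proof.
intros H; unfold gaussA; generalize (floorZ_bounds (/ x)); intros Hf.
assert (Hx : 1 < / x) by (rewrite <- Rinv_1; apply Rinv_lt_contravar; lra).
assert (0 < floorZ (/ x))%Z.
{ apply lt_IZR; lra. }
exists (pred (Z.to_nat (floorZ (/ x)))).
rewrite Nat.succ_pred by lia; split; auto.
rewrite INR_IZR_INZ, Z2Nat.id by lia.
assert (Hxx : x * / x = 1) by (field; lra).
split; [| nra].
rewrite Rmult_minus_distr_l, Hxx; ring.
Qed.

(* [Rmin] is [x] in the terms of the sum in [Phi] and [x * gaussA x] at the last
   [S j] with [S j * x <= 1]; [ln] vanishes beyond it.  So [Phi] is given by a single
   formula on both sides of [x = 1/n], where [floorZ (/ x)] jumps. *)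
Definition Phi_term (x : R) (j : nat) : R :=
  Rmin (1 - INR (S j) * x) x * ln (1 - INR (S j) * x).

Lemma Phi_eq (x : R) (N : nat) : 0 < x < 1 -> (Z.to_nat (floorZ (/ x)) <= N)%nat ->
  Phi x = x * ln x + sumR N (Phi_term x).
Proof.
intros Hx; unfold Phi; destruct (floor_inv_nat x Hx) as (m & -> & -> & Hu).
intros HN; induction HN as [| N HN IH].
- replace (S m - 1)%nat with m by lia; simpl sumR.
  rewrite sumR_scal, (sumR_ext m _ (Phi_term x)).
  + unfold Phi_term at 3; rewrite Rmin_left by lra; ring.
  + intros j Hj; unfold Phi_term; rewrite Rmin_right; auto.
    assert (Hj' : INR (S (S j)) <= INR (S m)) by (apply le_INR; lia).
    rewrite (S_INR (S j)) in Hj'; nra.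
- rewrite IH; simpl sumR; unfold Phi_term at 3; rewrite (ln_nonpos (1 - _)); [ring |].
  assert (Hj' : INR (S (S m)) <= INR (S N)) by (apply le_INR; lia).
  rewrite (S_INR (S m)) in Hj'; nra.
Qed.

Lemma Rmin_Rabs (a b : R) : Rmin a b = / 2 * (a + b - Rabs (a - b)).
Proof. unfold Rmin, Rabs; destruct Rle_dec; destruct Rcase_abs; lra. Qed.

Lemma continuous_Phi_term (j : nat) (x : R) : 0 < x -> continuous (fun x => Phi_term x j) x.
Proof.
intros Hx; unfold Phi_term; set (a := INR (S j)).
assert (Hlin : continuous (fun x => 1 - a * x) x).
{ apply (ex_derive_continuous (fun x => 1 - a * x)); auto_derive; auto. }
destruct (Rtotal_order (1 - a * x) 0) as [H | [H | H]].
- apply continuous_ext_loc with (fun _ => 0); [| apply continuous_const].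
  assert (Hn : locally x (fun y => 1 - a * y < 0)).
  { apply (Hlin (fun u => u < 0)); apply open_lt; auto. }
  revert Hn; apply filter_imp; intros y Hy; rewrite ln_nonpos; lra.
(* At x = 1/a the minimum is locally its first argument, so the term is u ln u with u = 1 - a y,
   which is continuous at u = 0. *)
- apply continuous_ext_loc with (fun x => (fun u => u * ln u) (1 - a * x));
    [| apply (continuous_comp (fun x => 1 - a * x) (fun u => u * ln u)); auto; apply continuous_xlnx].
  assert (Hn : locally x (fun y => 1 - a * y < x / 2)).
  { apply (Hlin (fun u => u < x / 2)); apply open_lt; lra. }
  assert (Hn' : locally x (fun y => x / 2 < y)) by (apply open_gt; lra).
  generalize (filter_and _ _ Hn Hn'); apply filter_imp; intros y Hy.
  rewrite Rmin_left by lra; auto.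
- apply (continuous_mult (fun x => Rmin (1 - a * x) x) (fun x => ln (1 - a * x))).
  + apply continuous_ext with (fun x => / 2 * ((1 - a * x + x) - Rabs (1 - a * x - x))).
    { intros y; symmetry; apply Rmin_Rabs. }
    apply (continuous_mult (fun _ => / 2) (fun x => (1 - a * x + x) - Rabs (1 - a * x - x)));
      [apply continuous_const |].
    apply (continuous_minus (fun x => 1 - a * x + x) (fun x => Rabs (1 - a * x - x))).
    * apply (ex_derive_continuous (fun x => 1 - a * x + x)); auto_derive; auto.
    * apply (continuous_comp (fun x => 1 - a * x - x) Rabs); [| apply continuous_Rabs].
      apply (ex_derive_continuous (fun x => 1 - a * x - x)); auto_derive; auto.
  + apply (ex_derive_continuous (fun x => ln (1 - a * x))); auto_derive; auto.
Qed.

Lemma floorZ_le (a b : R) : a <= b -> (floorZ a <= floorZ b)%Z.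
Proof.
intros H; apply Z.lt_succ_r, lt_IZR; rewrite succ_IZR.
generalize (floorZ_bounds a) (floorZ_bounds b); lra.
Qed.

Lemma continuous_Phi (x : R) : 0 < x < 1 -> continuous Phi x.
Proof.
(* Every y > x/2 has floor(1/y) <= N, so one finite sum represents [Phi] near x. *)
intros Hx; set (N := Z.to_nat (floorZ (/ (x / 2)))).
apply continuous_ext_loc with (fun x => x * ln x + sumR N (Phi_term x)).
- assert (H1 : locally x (fun y => x / 2 < y)) by (apply open_gt; lra).
  assert (H2 : locally x (fun y => y < 1)) by (apply open_lt; lra).
  generalize (filter_and _ _ H1 H2); apply filter_imp; intros y Hy.
  symmetry; apply Phi_eq; [lra |].
  apply Z2Nat.inj_le.
  + apply Z.le_trans with (floorZ 0); [| apply floorZ_le, Rlt_le, Rinv_0_lt_compat; lra].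
    rewrite (floorZ_unique 0 0); [lia | lra].
  + apply Z.le_trans with (floorZ 0); [| apply floorZ_le, Rlt_le, Rinv_0_lt_compat; lra].
    rewrite (floorZ_unique 0 0); [lia | lra].
  + apply floorZ_le, Rinv_le_contravar; lra.
- apply (continuous_plus (fun x => x * ln x) (fun x => sumR N (Phi_term x)));
    [apply continuous_xlnx |].
  apply (continuous_sumR N (fun j x => Phi_term x j)); intros j; apply continuous_Phi_term; lra.
Qed.

(* [u - u * ln u] is an antiderivative of [- ln u]; these two inequalities compare
   [x * ln u] with the integral of [ln] over [[u - x, u]] and over [[u, u + x]]. *)
Lemma ln_integral_lower (u x : R) : 0 < x <= u ->
  ((u - x) - (u - x) * ln (u - x)) - (u - u * ln u) <= x * ln u.
Proof.
intros [Hx [Hu | <-]].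
- assert (H : ln (u / (u - x)) <= u / (u - x) - 1)
    by (apply ln_le_minus_1, Rdiv_lt_0_compat; lra).
  rewrite ln_div in H by lra.
  apply Rmult_le_compat_l with (r := u - x) in H; [| lra].
  replace ((u - x) * (u / (u - x) - 1)) with x in H by (field; lra); lra.
- replace (x - x) with 0 by ring; lra.
Qed.

Lemma ln_integral_upper (u x : R) : 0 < x -> 0 < u ->
  x * ln u <= (u - u * ln u) - ((u + x) - (u + x) * ln (u + x)).
Proof.
intros Hx Hu.
assert (H : ln (u / (u + x)) <= u / (u + x) - 1)
  by (apply ln_le_minus_1, Rdiv_lt_0_compat; lra).
rewrite ln_div in H by lra.
apply Rmult_le_compat_l with (r := u + x) in H; [| lra].
replace ((u + x) * (u / (u + x) - 1)) with (- x) in H by (field; lra); lra.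
Qed.

(** The sum is a Riemann sum of step x for the integral of ln; comparing it with the antiderivative
    telescopes. The witness is u = 1 - nx = x A(x). In the lower bound the summand u ln u of [Phi]
    cancels the boundary term at u; in the upper bound the boundary term at 1 gives the -1 that
    becomes the limit of [Phi] at 0. *)
Lemma Phi_bounds (x : R) : 0 < x < 1 -> exists u, 0 <= u < x /\ u + x <= 1 /\
  x * ln x + u - (1 - x) + (1 - x) * ln (1 - x) <= Phi x /\
  Phi x <= x * ln x + u * ln u + (u + x) - (u + x) * ln (u + x) - 1.
Proof.
intros Hx; unfold Phi; destruct (floor_inv_nat x Hx) as (m & -> & -> & Hu).
replace (S m - 1)%nat with m by lia.
set (K := fun j : nat => (1 - INR j * x) - (1 - INR j * x) * ln (1 - INR j * x)).
assert (Hj : forall j, (j < m)%nat -> 0 < x <= 1 - INR (S j) * x).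
{ intros j Hj; split; [lra |].
  assert (Hj' : INR (S (S j)) <= INR (S m)) by (apply le_INR; lia).
  rewrite (S_INR (S j)) in Hj'; nra. }
exists (1 - INR (S m) * x); split; auto.
assert (E : 1 - INR (S m) * x + x = 1 - INR m * x) by (rewrite S_INR; ring).
rewrite E; split; [generalize (pos_INR m); nra |].
rewrite sumR_scal; split.
- assert (H : sumR m (fun j => K (S (S j)) - K (S j)) <=
              sumR m (fun j => x * ln (1 - INR (S j) * x))).
  { apply sumR_le; intros j Hjm; unfold K.
    replace (1 - INR (S (S j)) * x) with (1 - INR (S j) * x - x)
      by (rewrite (S_INR (S j)); ring).
    apply ln_integral_lower; auto. }
  rewrite (sumR_telescope m (fun j => K (S j))) in H; unfold K in H.
  change (INR 1) with 1 in H; rewrite Rmult_1_l in H; lra.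
- assert (H : sumR m (fun j => x * ln (1 - INR (S j) * x)) <=
              sumR m (fun j => K (S j) - K j)).
  { apply sumR_le; intros j Hjm; unfold K; generalize (Hj j Hjm); intros Hj'.
    replace (1 - INR j * x) with (1 - INR (S j) * x + x) by (rewrite S_INR; ring).
    apply ln_integral_upper; lra. }
  rewrite sumR_telescope in H; unfold K in H.
  change (INR 0) with 0 in H; rewrite Rmult_0_l, Rminus_0_r, ln_1 in H; lra.
Qed.

Lemma Phi_ge (x : R) : 0 < x < 1 -> -2 <= Phi x.
Proof.
intros Hx; destruct (Phi_bounds x Hx) as (u & Hu & Hux & Hl & _).
generalize (xlnx_ge x ltac:(lra)) (xlnx_ge (1 - x) ltac:(lra)); lra.
Qed.

(** The constant is 2 + 4: u + x < 2x <= 2 sqrt x, and -(u + x) ln(u + x) <= 2 sqrt(u + x) <= 4 sqrt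
    x. *)
Lemma Phi_near_0 (x : R) : 0 < x < 1 -> Rabs (Phi x + 1) <= 6 * sqrt x.
Proof.
intros Hx; destruct (Phi_bounds x Hx) as (u & Hu & Hux & Hl & Hr).
generalize (xlnx_ge_sqrt x ltac:(lra)) (xlnx_ge (1 - x) ltac:(lra))
  (xlnx_le_0 x ltac:(lra)) (xlnx_le_0 u ltac:(lra)) (xlnx_ge_sqrt (u + x) ltac:(lra)); intros.
assert (Hs : sqrt (u + x) <= 2 * sqrt x).
{ apply Rle_trans with (sqrt (4 * x)); [apply sqrt_le_1_alt; lra |].
  rewrite sqrt_mult by lra; replace 4 with (2 * 2) by ring; rewrite sqrt_square; lra. }
generalize (sqrt_lt_R0 x ltac:(lra)) (sqrt_sqrt x ltac:(lra)); intros.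
assert (sqrt x < 1) by (rewrite <- sqrt_1; apply sqrt_lt_1_alt; lra).
assert (Hxs : x <= sqrt x) by nra.
apply Rabs_le; split; lra.
Qed.

Lemma Phi_le_0 (x : R) : 0 < x < 1 -> Phi x <= 0.
Proof.
intros Hx; destruct (Phi_bounds x Hx) as (u & Hu & Hux & _ & Hr).
generalize (xlnx_le_0 x ltac:(lra)) (xlnx_le_0 u ltac:(lra)) (xlnx_ge (u + x) ltac:(lra)); lra.
Qed.

Lemma normZ_gaussA (x : R) : normZ (gaussA x) = normZ (/ x).
Proof. apply (normZ_fracR (/ x)). Qed.

(** Periodicity of [w] replaces [gaussA], which jumps at the points 1/n, by the continuous
    inverse. *)
Lemma w_gaussA (x : R) : w (gaussA x) = w (/ x).
Proof. rewrite !w_normZ, normZ_gaussA; auto. Qed.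

Lemma f_bound (x : R) : 0 < x < / 2 -> Rabs (Defs.f x) <= 5.
Proof.
intros Hx; unfold Defs.f.
generalize (w_bounds x) (w_bounds (gaussA x)) (Phi_ge x ltac:(lra)) (Phi_le_0 x ltac:(lra)).
intros; apply Rabs_le; split; nra.
Qed.

Lemma continuous_f (x : R) : 0 < x < 1 -> continuous Defs.f x.
Proof.
intros Hx; apply continuous_ext with (fun x => - w x - x * w (/ x) - Phi x).
{ intros y; unfold Defs.f; rewrite w_gaussA; auto. }
apply (continuous_minus (fun x => - w x - x * w (/ x)) Phi); [| apply continuous_Phi; auto].
apply (continuous_minus (fun x => - w x) (fun x => x * w (/ x))).
- apply (continuous_opp w), continuous_w.
- apply (continuous_mult (fun x => x) (fun x => w (/ x))); [apply continuous_id |].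
  apply (continuous_comp Rinv w); [| apply continuous_w].
  apply (ex_derive_continuous Rinv); auto_derive; lra.
Qed.

(** A(1/2) = 0 kills the middle term, and w(1/2) = ln 2 cancels Phi(1/2) = -ln 2. This makes the
    jump at 1/2 exact. *)
Lemma f_half : Defs.f (/ 2) = 0.
Proof.
unfold Defs.f; rewrite w_gaussA, Rinv_inv.
replace (w 2) with (w 0).
2: { rewrite !w_normZ; replace 2 with (0 + IZR 2) by ring; rewrite normZ_plus_IZR; auto. }
rewrite w_0, w_normZ, normZ_small, w0_eq by lra.
rewrite (Phi_eq (/ 2) 2); [| lra |].
- unfold sumR, Phi_term; simpl INR.
  rewrite Rmin_left by lra; rewrite (ln_nonpos (1 - (1 + 1) * / 2)) by lra.
  replace (1 - 1 * / 2) with (/ 2) by field; replace (1 - / 2) with (/ 2) by field; field.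
- rewrite Rinv_inv, (floorZ_unique 2 2) by lra; simpl; lia.
Qed.

Lemma f_at_right_0 : filterlim Defs.f (at_right 0) (locally 1).
Proof.
assert (Hw : filterlim w (at_right 0) (locally 0)).
{ rewrite <- w_0 at 2; eapply filterlim_filter_le_1; [apply filter_le_within |].
  apply continuous_w. }
apply filterlim_locally; intros [eps Heps]; simpl.
(* Half of eps is for w(x). The other half is for 8 sqrt x: 6 from [Phi_near_0] and 2 from x w(A(x))
   <= 2x <= 2 sqrt x. *)
assert (He8 : 0 < (eps / 2 / 8) ^ 2) by (apply pow_lt; lra).
assert (H1 : at_right 0 (fun x => Rabs (w x) < eps / 2)).
{ assert (He2 : 0 < eps / 2) by lra.
  generalize (proj1 (filterlim_locally w 0) Hw (mkposreal _ He2)); apply filter_imp.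
  intros x Hx; change (Rabs (w x - 0) < eps / 2) in Hx; rewrite Rminus_0_r in Hx; auto. }
assert (H2 : at_right 0 (fun x => x < (eps / 2 / 8) ^ 2)).
{ apply filter_le_within; apply open_lt; auto. }
assert (H3 : at_right 0 (fun x => x < 1)).
{ apply filter_le_within; apply open_lt; lra. }
assert (H4 : at_right 0 (fun x => 0 < x)).
{ exists (mkposreal _ Rlt_0_1); intros x _ Hx; exact Hx. }
generalize (filter_and _ _ (filter_and _ _ H1 H2) (filter_and _ _ H3 H4)).
apply filter_imp; intros x [[Hwx Hx2] [Hx1 Hx0]].
change (Rabs (Defs.f x - 1) < eps); unfold Defs.f.
generalize (sqrt_lt_eps 8 (eps / 2) x ltac:(lra) ltac:(lra) ltac:(lra)); intros Hs.
generalize (Phi_near_0 x ltac:(lra)) (w_bounds (gaussA x)); intros HP Hg.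
generalize (sqrt_lt_R0 x ltac:(lra)) (sqrt_sqrt x ltac:(lra)); intros.
assert (sqrt x < 1) by (rewrite <- sqrt_1; apply sqrt_lt_1_alt; lra).
assert (Hxs : x <= sqrt x) by nra.
assert (0 <= x * w (gaussA x) <= 2 * sqrt x) by nra.
apply Rabs_def2 in Hwx; apply Rabs_le_between in HP; apply Rabs_def1; lra.
Qed.

(** * Convergence, continuity and jumps of the partial sums *)

Lemma Dterm_bound (x : R) (i : nat) : in_dom x -> Rabs (Dterm x i) <= 5 * (/ 2) ^ i.
Proof.
revert x; induction i; intros x Hx.
- rewrite Dterm_0 by auto; generalize (f_bound x (proj1 Hx)); simpl; lra.
- rewrite Dterm_S by auto; rewrite !Rabs_mult, Rabs_Ropp, Rabs_sgnZ.
  generalize (IHi _ (A_half_in_dom x (proj2 Hx))); destruct Hx as [Hx _].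
  rewrite (Rabs_pos_eq x) by lra; intros H; simpl.
  generalize (Rabs_pos (Dterm (A_half x) i)); nra.
Qed.

Lemma ex_series_half : ex_series (fun n => (/ 2) ^ n).
Proof. apply ex_series_geom; rewrite Rabs_pos_eq; lra. Qed.

Lemma half_pow_pos (n : nat) : 0 < (/ 2) ^ n.
Proof. apply pow_lt; lra. Qed.

Lemma DeltaM_Series_dist (n : nat) (x : R) : in_dom x ->
  Rabs (DeltaM n x - Series (Dterm x)) <= 5 * (/ 2) ^ n.
Proof.
intros Hx.
assert (Hb : forall k, Rabs (Dterm x (S n + k)) <= 5 * (/ 2) ^ S n * (/ 2) ^ k).
{ intros k; rewrite Rmult_assoc, <- pow_add; apply Dterm_bound; auto. }
assert (Hg : ex_series (fun k => 5 * (/ 2) ^ S n * (/ 2) ^ k)).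
{ apply (ex_series_scal (5 * (/ 2) ^ S n) (fun k => (/ 2) ^ k)), ex_series_half. }
assert (He : ex_series (fun k => Rabs (Dterm x (S n + k)))).
{ apply (@ex_series_le R_AbsRing R_CompleteNormedModule) with (2 := Hg); intros k.
  change (Rabs (Rabs (Dterm x (S n + k))) <= 5 * (/ 2) ^ S n * (/ 2) ^ k).
  rewrite Rabs_Rabsolu; auto. }
assert (Hd : ex_series (Dterm x)).
{ apply (ex_series_incr_n (Dterm x) (S n)), ex_series_Rabs, He. }
rewrite (Series_incr_n _ (S n)) by (auto; lia); unfold DeltaM; simpl pred.
replace (_ - _) with (- Series (fun k => Dterm x (S n + k))) by ring.
rewrite Rabs_Ropp; eapply Rle_trans; [apply Series_Rabs, He |].
eapply Rle_trans; [apply Series_le with (2 := Hg); intros k; split; [apply Rabs_pos | auto] |].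
rewrite Series_scal_l, Series_geom by (rewrite Rabs_pos_eq; lra).
simpl; generalize (half_pow_pos n); lra.
Qed.

Lemma half_pow_small (eps : R) : 0 < eps -> exists N, forall n, (N <= n)%nat -> (/ 2) ^ n < eps.
Proof.
intros He; destruct (pow_lt_1_zero (/ 2) ltac:(rewrite Rabs_pos_eq; lra) eps He) as [N HN].
exists N; intros n Hn; generalize (HN n Hn).
rewrite Rabs_pos_eq; auto; apply Rlt_le, half_pow_pos.
Qed.

Lemma DeltaM_uniform : exists g : R -> R, forall eps : R, 0 < eps ->
  exists N : nat, forall n : nat, (N <= n)%nat ->
    forall x : R, in_dom x -> Rabs (DeltaM n x - g x) < eps.
Proof.
exists (fun x => Series (Dterm x)); intros eps Heps.
destruct (half_pow_small (eps / 5)) as [N HN]; [lra |].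
exists N; intros n Hn x Hx; generalize (DeltaM_Series_dist n x Hx) (HN n Hn); lra.
Qed.

(** The bound is the fixed point of c = 5 + c/2, hence independent of [M]. *)
Lemma oddper_DeltaM_bound (M : nat) (z : R) : irrationalR z ->
  Rabs (oddper (DeltaM M) z) <= 10.
Proof.
revert z; induction M; intros z Hz; unfold oddper; rewrite Rabs_mult, Rabs_sgnZ, Rmult_1_l;
  generalize (normZ_in_dom z Hz); intros Hx.
- rewrite DeltaM_0 by auto; generalize (f_bound _ (proj1 Hx)); lra.
- rewrite DeltaM_S by auto; destruct Hx as [Hx Hi].
  generalize (f_bound _ Hx) (IHM _ (irrationalR_inv _ Hi)); intros H1 H2.
  apply Rabs_le_between in H1; apply Rabs_le_between in H2; apply Rabs_le; split; nra.
Qed.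

(* Limit at [r] along the irrationals [y] such that [s (y - r)]. *)
Definition ilim (s : R -> Prop) (g : R -> R) (r L : R) : Prop :=
  filterlim g (within (fun y => irrationalR y /\ s (y - r)) (locally r)) (locally L).

Definition side_right (t : R) : Prop := 0 < t.
Definition side_left (t : R) : Prop := t < 0.

Lemma ilim_iff (s : R -> Prop) (g : R -> R) (r L : R) :
  ilim s g r L <-> forall eps, 0 < eps -> exists delta, 0 < delta /\
    forall y, irrationalR y -> s (y - r) -> Rabs (y - r) < delta -> Rabs (g y - L) < eps.
Proof.
unfold ilim; rewrite filterlim_locally; split.
- intros H eps Heps; destruct (H (mkposreal _ Heps)) as [d Hd].
  exists d; split; [apply cond_pos |]; intros y Hy Hs Hyr; apply (Hd y Hyr); auto.
- intros H [eps Heps]; destruct (H eps Heps) as (d & Hd0 & Hd).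
  exists (mkposreal _ Hd0); intros y Hyr [Hy Hs]; apply (Hd y Hy Hs Hyr).
Qed.

Lemma ilim_comp (s s' : R -> Prop) (g T : R -> R) (r r' L : R) :
  T r = r' -> continuous T r ->
  locally r (fun y => irrationalR y -> s (y - r) -> irrationalR (T y) /\ s' (T y - r')) ->
  ilim s' g r' L -> ilim s (fun y => g (T y)) r L.
Proof.
intros <- HT Hs Hg; unfold ilim.
apply filterlim_comp with (2 := Hg); intros P HP.
assert (HP' : locally r (fun y => irrationalR (T y) /\ s' (T y - T r) -> P (T y)))
  by apply (HT _ HP).
generalize (filter_and _ _ HP' Hs); unfold filtermap, within; apply filter_imp.
intros y [H1 H2] [H3 H4]; auto.
Qed.

Lemma ilim_ext_loc (s : R -> Prop) (g h : R -> R) (r L : R) :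
  locally r (fun y => irrationalR y -> s (y - r) -> g y = h y) ->
  ilim s g r L -> ilim s h r L.
Proof.
intros H; apply filterlim_ext_loc; revert H; unfold within; apply filter_imp.
intros y Hy [H1 H2]; auto.
Qed.

Lemma ilim_continuous (s : R -> Prop) (g : R -> R) (r : R) :
  continuous g r -> ilim s g r (g r).
Proof. intros H; eapply filterlim_filter_le_1; [apply filter_le_within | apply H]. Qed.

Lemma ilim_opp (s : R -> Prop) (g : R -> R) (r L : R) :
  ilim s g r L -> ilim s (fun y => - g y) r (- L).
Proof. intros H; eapply filterlim_comp; [apply H | apply (filterlim_opp L)]. Qed.

Lemma ilim_minus (s : R -> Prop) (g h : R -> R) (r a b : R) :
  ilim s g r a -> ilim s h r b -> ilim s (fun y => g y - h y) r (a - b).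
Proof.
intros Hg Hh; apply filterlim_comp_2 with (1 := Hg) (2 := ilim_opp _ _ _ _ Hh).
apply (filterlim_plus a (- b)).
Qed.

Lemma ilim_id_mult (s : R -> Prop) (h : R -> R) (r b : R) :
  ilim s h r b -> ilim s (fun y => y * h y) r (r * b).
Proof.
intros Hh; eapply filterlim_comp_2 with (2 := Hh).
- apply (ilim_continuous s (fun y => y)), continuous_id.
- apply (filterlim_mult r b).
Qed.

Lemma oddper_ilim_plus_IZR (s : R -> Prop) (g : R -> R) (r L : R) (k : Z) :
  ilim s (oddper g) r L -> ilim s (oddper g) (r + IZR k) L.
Proof.
intros H; apply ilim_ext_loc with (fun y => oddper g (y - IZR k)).
- apply filter_forall; intros y _ _.
  replace y with (y - IZR k + IZR k) at 2 by ring; rewrite oddper_plus_IZR; auto.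
- apply ilim_comp with (4 := H) (T := fun y => y - IZR k); [ring | |].
  + apply (ex_derive_continuous (fun y => y - IZR k)); auto_derive; auto.
  + apply filter_forall; intros y Hy Hs; split; [apply irrationalR_minus_IZR; auto |].
    replace (y - IZR k - r) with (y - (r + IZR k)) by ring; auto.
Qed.

Lemma oddper_ilim_opp (s s' : R -> Prop) (g : R -> R) (r L : R) :
  (forall t, s' t -> s (- t)) ->
  ilim s (oddper g) r L -> ilim s' (oddper g) (- r) (- L).
Proof.
intros Hss H; apply ilim_ext_loc with (fun y => - oddper g (- y)).
- apply filter_forall; intros y Hy _; rewrite oddper_opp by auto; ring.
- apply (ilim_opp s' (fun y => oddper g (- y))).
  apply ilim_comp with (4 := H) (T := Ropp); [ring | |].
  + apply (ex_derive_continuous Ropp); auto_derive; auto.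
  + apply filter_forall; intros y Hy Hs; split; [apply irrationalR_opp; auto |].
    replace (- y - r) with (- (y - - r)) by ring; auto.
Qed.

(** The upper bound is required only on the side [s], so that r = 1/2 can be approached from the
    left. *)
Lemma locally_in_dom (s : R -> Prop) (r : R) : 0 < r ->
  locally r (fun y => s (y - r) -> y < / 2) ->
  locally r (fun y => irrationalR y -> s (y - r) -> in_dom y).
Proof.
intros Hr Hs; assert (H : locally r (fun y => 0 < y)) by (apply open_gt; auto).
generalize (filter_and _ _ H Hs); apply filter_imp; intros y [H1 H2] Hy Hys; split; auto.
Qed.

Lemma ilim_DeltaM_0 (s : R -> Prop) (r : R) : 0 < r < 1 ->
  locally r (fun y => s (y - r) -> y < / 2) ->
  ilim s (oddper (DeltaM 0)) r (Defs.f r).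
Proof.
intros Hr Hs; apply ilim_ext_loc with Defs.f; [| apply ilim_continuous, continuous_f; lra].
generalize (locally_in_dom s r (proj1 Hr) Hs); apply filter_imp; intros y Hd Hy Hys.
rewrite oddper_in_dom, DeltaM_0; auto.
Qed.

Lemma ilim_DeltaM_S (s s' : R -> Prop) (M : nat) (r L : R) : 0 < r < 1 ->
  locally r (fun y => s (y - r) -> y < / 2) ->
  (forall y, 0 < y -> s (y - r) -> s' (/ y - / r)) ->
  ilim s' (oddper (DeltaM M)) (/ r) L ->
  ilim s (oddper (DeltaM (S M))) r (Defs.f r - r * L).
Proof.
intros Hr Hs Hss H.
apply ilim_ext_loc with (fun y => Defs.f y - y * oddper (DeltaM M) (/ y)).
- generalize (locally_in_dom s r (proj1 Hr) Hs); apply filter_imp; intros y Hd Hy Hys.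
  rewrite (oddper_in_dom _ y), DeltaM_S; auto.
- apply ilim_minus; [apply ilim_continuous, continuous_f; lra |].
  apply (ilim_id_mult s (fun y => oddper (DeltaM M) (/ y))).
  apply ilim_comp with (4 := H) (T := Rinv); auto.
  + apply (ex_derive_continuous Rinv); auto_derive; lra.
  + assert (Hp : locally r (fun y => 0 < y)) by (apply open_gt; lra).
    revert Hp; apply filter_imp; intros y Hy0 Hy Hys; split; auto.
    apply irrationalR_inv; auto.
Qed.

(** Brings a point such as 1/x back to [0,1/2], where the recursion for [DeltaM] applies. *)
Lemma normZ_reduction (P : R -> Prop) :
  (forall r k, P r -> P (r + IZR k)) -> (forall r, P r -> P (- r)) ->
  forall z, P (normZ z) -> P z.
Proof.
intros Hk Ho z H.
assert (E : z = normZ z + IZR (nintZ z) \/ z = - normZ z + IZR (nintZ z)).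
{ unfold normZ, Rabs; destruct Rcase_abs; [right | left]; ring. }
destruct E as [E | E]; rewrite E; auto.
Qed.

Lemma locally_lt (s : R -> Prop) (r b : R) : r < b ->
  locally r (fun y => s (y - r) -> y < b).
Proof.
intros H; generalize (open_lt b r H); apply filter_imp; auto.
Qed.

Lemma ilim_DeltaM_irrational (M : nat) (z : R) : irrationalR z ->
  ilim (fun _ => True) (oddper (DeltaM M)) z (oddper (DeltaM M) z).
Proof.
(* This reduction serves both the base case and the step; the induction must cover all irrationals,
   because the step evaluates at 1/x. *)
assert (Hred : forall M, (forall x, in_dom x ->
    ilim (fun _ => True) (oddper (DeltaM M)) x (oddper (DeltaM M) x)) ->
  forall z, irrationalR z ->
    ilim (fun _ => True) (oddper (DeltaM M)) z (oddper (DeltaM M) z)).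
{ clear; intros M H z; pattern z; apply normZ_reduction.
  - intros r k Hr Hrk; rewrite oddper_plus_IZR; apply oddper_ilim_plus_IZR, Hr.
    replace r with (r + IZR k + IZR (- k)) by (rewrite opp_IZR; ring).
    apply irrationalR_plus_IZR; auto.
  - intros r Hr Hor; apply irrationalR_opp in Hor; rewrite Ropp_involutive in Hor.
    rewrite oddper_opp by auto; apply oddper_ilim_opp with (2 := Hr Hor); auto.
  - intros Hn; apply H, in_dom_normZ_irrational; auto. }
revert z; induction M as [| M IH]; apply Hred; intros x Hx; rewrite oddper_in_dom by auto;
  destruct Hx as [Hx Hi].
- rewrite DeltaM_0 by (split; auto); apply ilim_DeltaM_0; [lra | apply (locally_lt (fun _ => True)); lra].
- rewrite DeltaM_S by (split; auto); apply ilim_DeltaM_S with (fun _ => True); auto; [lra | |].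
  + apply (locally_lt (fun _ => True)); lra.
  + apply IH, irrationalR_inv; auto.
Qed.

(** There is no control on E_M(1/y) as y tends to 0 beyond its boundedness, but the factor y makes
    that enough; only the limit of [f] survives. *)
Lemma ilim_DeltaM_0_right (M : nat) : ilim side_right (oddper (DeltaM M)) 0 1.
Proof.
assert (Hf : ilim side_right Defs.f 0 1).
{ eapply filterlim_filter_le_1; [| apply f_at_right_0].
  intros P; unfold at_right, within, side_right; apply filter_imp.
  intros y Hy [_ H]; apply Hy; lra. }
assert (Hd : locally 0 (fun y => irrationalR y -> side_right (y - 0) -> in_dom y)).
{ assert (H : locally 0 (fun y => y < / 2)) by (apply open_lt; lra).
  revert H; apply filter_imp; unfold side_right; intros y H Hy Hs; split; auto; lra. }
destruct M as [| M].
- apply ilim_ext_loc with (2 := Hf); revert Hd; apply filter_imp; intros y Hd Hy Hs.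
  rewrite oddper_in_dom, DeltaM_0; auto.
- apply ilim_ext_loc with (fun y => Defs.f y - y * oddper (DeltaM M) (/ y)).
  { revert Hd; apply filter_imp; intros y Hd Hy Hs; rewrite (oddper_in_dom _ y), DeltaM_S; auto. }
  replace 1 with (1 - 0) by ring; apply ilim_minus; auto.
  apply ilim_iff; intros eps Heps; exists (eps / 10); split; [lra |].
  intros y Hy _ Hy0; rewrite Rminus_0_r in Hy0 |- *; rewrite Rabs_mult.
  generalize (oddper_DeltaM_bound M _ (irrationalR_inv _ Hy)) (Rabs_pos y); nra.
Qed.

(** * Jumps at rational points *)

Definition jump (g : R -> R) (r c : R) : Prop :=
  exists Lp Lm, ilim side_right g r Lp /\ ilim side_left g r Lm /\ Lp - Lm = c.

Lemma jump_plus_IZR (g : R -> R) (r c : R) (k : Z) :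
  jump (oddper g) r c -> jump (oddper g) (r + IZR k) c.
Proof.
intros (Lp & Lm & H1 & H2 & H); exists Lp, Lm.
split; [| split]; auto; apply oddper_ilim_plus_IZR; auto.
Qed.

Lemma jump_opp (g : R -> R) (r c : R) : jump (oddper g) r c -> jump (oddper g) (- r) c.
Proof.
intros (Lp & Lm & H1 & H2 & H); exists (- Lm), (- Lp).
split; [| split; [| lra]].
- apply oddper_ilim_opp with (2 := H2); unfold side_left, side_right; intros; lra.
- apply oddper_ilim_opp with (2 := H1); unfold side_left, side_right; intros; lra.
Qed.

Lemma Rinv_side_right (r y : R) : 0 < r -> 0 < y -> side_right (y - r) -> side_left (/ y - / r).
Proof.
unfold side_left, side_right; intros Hr Hy H.
apply Rlt_minus, Rinv_lt_contravar; [apply Rmult_lt_0_compat |]; lra.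
Qed.

Lemma Rinv_side_left (r y : R) : 0 < r -> 0 < y -> side_left (y - r) -> side_right (/ y - / r).
Proof.
unfold side_left, side_right; intros Hr Hy H.
apply Rlt_Rminus, Rinv_lt_contravar; [apply Rmult_lt_0_compat |]; lra.
Qed.

Lemma jump_DeltaM_0 (r : R) : 0 < r < / 2 -> jump (oddper (DeltaM 0)) r 0.
Proof.
intros Hr; exists (Defs.f r), (Defs.f r).
split; [| split; [| ring]]; (apply ilim_DeltaM_0; [lra | apply locally_lt; lra]).
Qed.

(** Inversion exchanges the two sides and the minus sign of the recursion exchanges them back, so
    the jump keeps its sign; the continuous [f] contributes nothing. *)
Lemma jump_DeltaM_S (M : nat) (r c : R) : 0 < r < / 2 ->
  jump (oddper (DeltaM M)) (/ r) c -> jump (oddper (DeltaM (S M))) r (r * c).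
Proof.
intros Hr (Lp & Lm & H1 & H2 & H).
exists (Defs.f r - r * Lm), (Defs.f r - r * Lp); split; [| split].
- apply ilim_DeltaM_S with side_left; auto; [lra | apply locally_lt; lra |].
  intros y Hy; apply Rinv_side_right; lra.
- apply ilim_DeltaM_S with side_right; auto; [lra | apply locally_lt; lra |].
  intros y Hy; apply Rinv_side_left; lra.
- rewrite <- H; ring.
Qed.

Lemma jump_DeltaM_int (M : nat) : jump (oddper (DeltaM M)) 0 2.
Proof.
exists 1, (- (1)); split; [| split; [| ring]]; [apply ilim_DeltaM_0_right |].
rewrite <- Ropp_0; apply oddper_ilim_opp with (2 := ilim_DeltaM_0_right M).
unfold side_left, side_right; intros; lra.
Qed.

(* The right limit at 1/2 is minus the left one, by oddness and periodicity. *)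
Lemma jump_half_of_left (g : R -> R) (L : R) :
  ilim side_left (oddper g) (/ 2) L -> jump (oddper g) (/ 2) (- 2 * L).
Proof.
intros H; exists (- L), L; split; [| split; [auto | ring]].
replace (/ 2) with (- / 2 + IZR 1) by field.
apply oddper_ilim_plus_IZR, oddper_ilim_opp with (2 := H).
unfold side_left, side_right; intros; lra.
Qed.

Lemma locally_left (r b : R) : r <= b -> locally r (fun y => side_left (y - r) -> y < b).
Proof. intros H; apply filter_forall; unfold side_left; intros; lra. Qed.

Lemma jump_DeltaM_0_half : jump (oddper (DeltaM 0)) (/ 2) 0.
Proof.
replace 0 with (- 2 * Defs.f (/ 2)) by (rewrite f_half; ring).
apply jump_half_of_left, ilim_DeltaM_0; [lra | apply locally_left; lra].
Qed.

Lemma jump_DeltaM_S_half (M : nat) : jump (oddper (DeltaM (S M))) (/ 2) 1.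
Proof.
(* The left limit at 1/2 is f(1/2) - (1/2) * 1 = -1/2: from the left, 1/y tends to 2 from the right,
   where the limit is that at 0+. *)
replace 1 with (- 2 * (Defs.f (/ 2) - / 2 * 1)) by (rewrite f_half; field).
apply jump_half_of_left, ilim_DeltaM_S with side_right; [lra | apply locally_left; lra | |].
- intros y Hy; apply Rinv_side_left; lra.
- rewrite Rinv_inv; replace 2 with (0 + IZR 2) by ring.
  apply oddper_ilim_plus_IZR, ilim_DeltaM_0_right.
Qed.

(** Zeros are counted from index 0 after reduction, so that integers have depth 0 and half-integers
    depth 1; these are the points where the induction starts. *)
Definition depth_le (M : nat) (r : R) : Prop :=
  exists i, (i <= M)%nat /\ nicf_x (normZ r) i = 0.

Lemma depth_le_S (M : nat) (r : R) : 0 < r <= / 2 ->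
  depth_le (S M) r <-> depth_le M (/ r).
Proof.
intros Hr; unfold depth_le; rewrite (normZ_small r) by lra; split.
- intros ([| i] & Hi & H); [simpl in H; lra |].
  exists i; split; [lia |]; rewrite nicf_x_S, A_half_normZ in H; auto.
- intros (i & Hi & H); exists (S i); split; [lia |].
  rewrite nicf_x_S, A_half_normZ; auto.
Qed.

(** A zero jump encodes a two-sided limit, so a single induction treats deep and shallow
    rationals. *)
Definition jump_law (M : nat) (q r : R) : Prop :=
  (depth_le M r -> jump (oddper (DeltaM M)) r (2 / q)) /\
  (~ depth_le M r -> jump (oddper (DeltaM M)) r 0).

(** The denominator, which determines the jump, survives the reduction to [0,1/2]. *)
Lemma normZ_fraction (p q : Z) : (0 < q)%Z -> Z.gcd p q = 1%Z -> exists p',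
  Z.gcd p' q = 1%Z /\ normZ (IZR p / IZR q) = IZR p' / IZR q.
Proof.
intros Hq Hg; set (k := nintZ (IZR p / IZR q)); apply IZR_lt in Hq.
assert (E : IZR p / IZR q - IZR k = IZR (p - k * q) / IZR q).
{ rewrite minus_IZR, mult_IZR; field; lra. }
assert (Hg' : Z.gcd (p - k * q) q = 1%Z).
{ rewrite Z.gcd_comm; replace (p - k * q)%Z with (p + (- k) * q)%Z by ring.
  rewrite Z.gcd_add_mult_diag_r, Z.gcd_comm; auto. }
unfold normZ, Rabs; fold k; rewrite E; destruct Rcase_abs.
- exists (- (p - k * q))%Z; rewrite Z.gcd_opp_l, opp_IZR; split; auto; field; lra.
- exists (p - k * q)%Z; auto.
Qed.

Lemma jump_law_reduction (M : nat) :
  (forall p q, (0 < q)%Z -> Z.gcd p q = 1%Z -> 0 <= IZR p / IZR q <= / 2 ->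
    jump_law M (IZR q) (IZR p / IZR q)) ->
  forall p q, (0 < q)%Z -> Z.gcd p q = 1%Z -> jump_law M (IZR q) (IZR p / IZR q).
Proof.
intros H p q Hq Hg; pattern (IZR p / IZR q) at 1; apply normZ_reduction.
- intros r k [H1 H2]; split; unfold depth_le; rewrite normZ_plus_IZR; intros Hd;
    apply jump_plus_IZR; auto.
- intros r [H1 H2]; split; unfold depth_le; rewrite normZ_opp; intros Hd;
    apply jump_opp; auto.
- destruct (normZ_fraction p q Hq Hg) as (p' & Hg' & E); rewrite E.
  apply H; auto; rewrite <- E; apply normZ_bounds.
Qed.

(** Coprimality forces the denominators 1 at 0 and 2 at 1/2, which turn 2/q into the jumps 2 and 1
    found there. *)
Lemma fraction_le_half_cases (p q : Z) : (0 < q)%Z -> Z.gcd p q = 1%Z ->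
  0 <= IZR p / IZR q <= / 2 ->
  p = 0%Z /\ q = 1%Z \/ p = 1%Z /\ q = 2%Z \/ (0 < p)%Z /\ 0 < IZR p / IZR q < / 2.
Proof.
intros Hq Hg [H1 H2]; generalize (IZR_lt _ _ Hq); intros HqR.
assert (E : IZR p = IZR p / IZR q * IZR q) by (field; lra).
assert (Hp : (0 <= p)%Z) by (apply le_IZR; nra).
destruct (Z.eq_dec p 0) as [-> | Hp0].
{ left; split; auto; rewrite Z.gcd_0_l in Hg; lia. }
assert (Hp' : (0 < p)%Z) by lia; generalize (IZR_lt _ _ Hp'); intros HpR; right.
destruct (Z.eq_dec q (2 * p)) as [-> | Hne].
- left; rewrite Z.mul_comm, Z.gcd_mul_diag_l in Hg; lia.
- right; split; auto; split; [apply Rdiv_lt_0_compat; auto |].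
  destruct H2 as [H2 | H2]; auto; exfalso; apply Hne, eq_IZR.
  rewrite mult_IZR; rewrite H2 in E; lra.
Qed.

Lemma jump_law_DeltaM (M : nat) (p q : Z) : (0 < q)%Z -> Z.gcd p q = 1%Z ->
  jump_law M (IZR q) (IZR p / IZR q).
Proof.
revert p q; induction M as [| M IH]; apply jump_law_reduction; intros p q Hq Hg Hr;
  destruct (fraction_le_half_cases p q Hq Hg Hr) as [[-> ->] | [[-> ->] | [Hp Hr']]].
(* The point 0, in the base case and in the step: its orbit vanishes at index 0, so the second
   alternative is void. *)
1, 4: replace (0 / 1) with 0 by field; split; intros Hd;
  [replace (2 / 1) with 2 by field; apply jump_DeltaM_int |
   exfalso; apply Hd; exists 0%nat; split; [lia |]; apply normZ_small; lra].
- replace (1 / 2) with (/ 2) by field; split; intros Hd; [exfalso | apply jump_DeltaM_0_half].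
  destruct Hd as (i & Hi & H); replace i with 0%nat in H by lia.
  simpl in H; rewrite normZ_small in H; lra.
- split; intros Hd; [exfalso | apply jump_DeltaM_0; auto].
  destruct Hd as (i & Hi & H); replace i with 0%nat in H by lia.
  simpl in H; rewrite normZ_small in H; lra.
- replace (1 / 2) with (/ 2) by field; split; intros Hd.
  + replace (2 / 2) with 1 by field; apply jump_DeltaM_S_half.
  (* 1/2 inverts to the integer 2, so its depth is 1 and cannot exceed M + 1. *)
  + exfalso; apply Hd, depth_le_S; [lra |].
    exists 0%nat; split; [lia |]; rewrite Rinv_inv; simpl.
    replace 2 with (0 + IZR 2) by ring; rewrite normZ_plus_IZR; apply normZ_small; lra.
- rewrite Z.gcd_comm in Hg; destruct (IH q p Hp Hg) as [H1 H2].
  apply IZR_lt in Hp; apply IZR_lt in Hq.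
  assert (E : IZR q / IZR p = / (IZR p / IZR q)) by (field; lra); rewrite E in H1, H2.
  split; rewrite depth_le_S by lra; intros Hd.
  + replace (2 / IZR q) with (IZR p / IZR q * (2 / IZR p)) by (field; lra).
    apply jump_DeltaM_S; auto.
  + replace 0 with (IZR p / IZR q * 0) by ring; apply jump_DeltaM_S; auto.
Qed.

Lemma DeltaM_continuous (M : nat) (x : R) : in_dom x ->
  forall eps, 0 < eps -> exists delta, 0 < delta /\
    forall y, in_dom y -> Rabs (y - x) < delta -> Rabs (DeltaM M y - DeltaM M x) < eps.
Proof.
intros Hx eps Heps; generalize (ilim_DeltaM_irrational M x (proj2 Hx)); rewrite ilim_iff.
intros H; destruct (H eps Heps) as (d & Hd & Hd'); exists d; split; auto.
intros y Hy Hyx; generalize (Hd' y (proj2 Hy) I Hyx).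
rewrite !oddper_in_dom; auto.
Qed.

Lemma ilim_DeltaM_in_dom (s : R -> Prop) (M : nat) (r L : R) :
  ilim s (oddper (DeltaM M)) r L -> forall eps, 0 < eps -> exists delta, 0 < delta /\
    forall y, in_dom y -> s (y - r) -> Rabs (y - r) < delta -> Rabs (DeltaM M y - L) < eps.
Proof.
rewrite ilim_iff; intros H eps Heps; destruct (H eps Heps) as (d & Hd & Hd').
exists d; split; auto; intros y Hy Hs Hyr; generalize (Hd' y (proj2 Hy) Hs Hyr).
rewrite oddper_in_dom; auto.
Qed.

Lemma rationalR_lowest_terms (r : R) : rationalR r ->
  exists p q, (0 < q)%Z /\ Z.gcd p q = 1%Z /\ r = IZR p / IZR q.
Proof.
assert (Hpos : forall p q, (0 < q)%Z -> exists p' q', (0 < q')%Z /\ Z.gcd p' q' = 1%Z /\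
  IZR p / IZR q = IZR p' / IZR q').
{ intros p q Hq; set (g := Z.gcd p q).
  assert (Hg0 : (0 < g)%Z).
  { generalize (Z.gcd_nonneg p q); fold g; intros Hg.
    destruct (Z.eq_dec g 0) as [E | E]; [| lia].
    apply Z.gcd_eq_0_r in E; lia. }
  destruct (Z.gcd_divide_l p q) as [p' Hp']; destruct (Z.gcd_divide_r p q) as [q' Hq'].
  fold g in Hp', Hq'; exists p', q'.
  assert (Hq0 : (0 < q')%Z) by nia; split; auto; split.
  - assert (E : (Z.gcd p' q' * g)%Z = g).
    { rewrite <- Z.gcd_mul_mono_r_nonneg by lia; rewrite <- Hp', <- Hq'; auto. }
    nia.
  - rewrite Hp', Hq', !mult_IZR; field; split; apply not_0_IZR; lia. }
intros (p & q & Hq & ->); destruct (Z_lt_le_dec 0 q) as [H | H]; [apply Hpos; auto |].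
replace (IZR p / IZR q) with (IZR (- p) / IZR (- q)).
- apply Hpos; lia.
- rewrite !opp_IZR; field; apply not_0_IZR; auto.
Qed.

Lemma DeltaM_limit_rational (M : nat) (r : R) : 0 < r < / 2 -> rationalR r ->
  (exists d, is_depth r d /\ (M < d)%nat) ->
  exists L, forall eps, 0 < eps -> exists delta, 0 < delta /\
    forall y, in_dom y -> 0 < Rabs (y - r) < delta -> Rabs (DeltaM M y - L) < eps.
Proof.
intros Hr Hrat (d & (_ & _ & Hd) & HMd).
destruct (rationalR_lowest_terms r Hrat) as (p & q & Hq & Hg & E).
destruct (jump_law_DeltaM M p q Hq Hg) as [_ H]; rewrite <- E in H.
destruct H as (Lp & Lm & Hp & Hm & HL).
{ intros (i & Hi & H); rewrite normZ_small in H by lra.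
  destruct i; [simpl in H; lra |]; apply (Hd (S i)); auto; lia. }
exists Lp; intros eps Heps.
destruct (ilim_DeltaM_in_dom _ _ _ _ Hp eps Heps) as (d1 & Hd1 & H1).
destruct (ilim_DeltaM_in_dom _ _ _ _ Hm eps Heps) as (d2 & Hd2 & H2).
exists (Rmin d1 d2); split; [apply Rmin_pos; auto |].
generalize (Rmin_l d1 d2) (Rmin_r d1 d2); intros Hmin1 Hmin2 y Hy [Hy0 Hyd].
destruct (Rtotal_order y r) as [Hyr | [-> | Hyr]].
- replace Lp with Lm by lra; apply H2; auto; unfold side_left; lra.
- rewrite Rminus_diag, Rabs_R0 in Hy0; lra.
- apply H1; auto; unfold side_right; lra.
Qed.

Lemma DeltaM_jump_rational (M : nat) (p q : Z) : (0 < q)%Z -> Z.gcd p q = 1%Z ->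
  0 < IZR p / IZR q < / 2 ->
  (exists d, is_depth (IZR p / IZR q) d /\ (d <= M)%nat) ->
  exists Lp Lm,
    (forall eps, 0 < eps -> exists delta, 0 < delta /\
       forall y, in_dom y -> IZR p / IZR q < y < IZR p / IZR q + delta ->
         Rabs (DeltaM M y - Lp) < eps)
    /\
    (forall eps, 0 < eps -> exists delta, 0 < delta /\
       forall y, in_dom y -> IZR p / IZR q - delta < y < IZR p / IZR q ->
         Rabs (DeltaM M y - Lm) < eps)
    /\ Lp - Lm = 2 / IZR q.
Proof.
intros Hq Hg Hr (d & (_ & Hd & _) & HdM).
destruct (jump_law_DeltaM M p q Hq Hg) as [H _].
destruct H as (Lp & Lm & Hp & Hm & HL).
{ exists d; rewrite normZ_small by lra; auto. }
exists Lp, Lm; split; [| split]; auto; intros eps Heps.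
- destruct (ilim_DeltaM_in_dom _ _ _ _ Hp eps Heps) as (d1 & Hd1 & H1).
  exists d1; split; auto; intros y Hy Hyr; apply H1; auto; [unfold side_right; lra |].
  apply Rabs_def1; lra.
- destruct (ilim_DeltaM_in_dom _ _ _ _ Hm eps Heps) as (d1 & Hd1 & H1).
  exists d1; split; auto; intros y Hy Hyr; apply H1; auto; [unfold side_left; lra |].
  apply Rabs_def1; lra.
Qed.

(** * Brjuno numbers *)

Definition unit_irr (y : R) : Prop := 0 < y < 1 /\ irrationalR y.

Definition brj (y : R) : Prop := unit_irr y /\ ex_series (termB y).

(** Convertible to [termB] at [gaussA] and to [termB0] at [gaussA0], so both series share the lemmas
    below. *)
Definition term (A : R -> R) (y : R) (j : nat) : R :=
  prodR j (fun k => Nat.iter k A y) * ln (/ Nat.iter j A y).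

Lemma term_0 (A : R -> R) (y : R) : 0 < y -> term A y 0 = - ln y.
Proof. intros Hy; unfold term; simpl; rewrite ln_Rinv by auto; ring. Qed.

Lemma term_S (A : R -> R) (y : R) (j : nat) : term A y (S j) = y * term A (A y) j.
Proof.
unfold term; rewrite prodR_S, Nat.iter_succ_r.
rewrite (prodR_ext j _ (fun k => Nat.iter k A (A y))) by (intros; apply Nat.iter_succ_r).
simpl; ring.
Qed.

Lemma term_nonneg (A : R -> R) (y : R) (j : nat) :
  (forall y, unit_irr y -> unit_irr (A y)) -> unit_irr y -> 0 <= term A y j.
Proof.
intros HA; revert y; induction j; intros y Hy.
- rewrite term_0 by apply Hy; generalize (ln_le_0 y); destruct Hy; lra.
- rewrite term_S; generalize (IHj _ (HA y Hy)); destruct Hy; nra.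
Qed.

Lemma fracR_unit_irr (z : R) : irrationalR z -> unit_irr (fracR z).
Proof.
intros Hz; apply fracR_irrational in Hz; split; auto.
generalize (fracR_bounds z) (irrationalR_neq_0 _ Hz); lra.
Qed.

Lemma gaussA_unit_irr (y : R) : unit_irr y -> unit_irr (gaussA y).
Proof. intros [_ Hy]; apply (fracR_unit_irr (/ y)), irrationalR_inv; auto. Qed.

Lemma unit_irr_1_minus (y : R) : unit_irr y -> unit_irr (1 - y).
Proof. intros [Hy Hi]; split; [lra | apply irrationalR_1_minus; auto]. Qed.

Lemma in_dom_unit_irr (x : R) : in_dom x -> unit_irr x.
Proof. intros [Hx Hi]; split; auto; lra. Qed.

Lemma unit_irr_cases (y : R) : unit_irr y ->
  in_dom y \/ exists x, in_dom x /\ y = 1 - x.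
Proof.
intros [Hy Hi]; destruct (Rlt_le_dec y (/ 2)) as [H | H]; [left; split; auto; lra |].
right; exists (1 - y); split; [split | ring]; [| apply irrationalR_1_minus; auto].
generalize (irrationalR_neq_half _ Hi); lra.
Qed.

Lemma floorZ_plus_IZR (z : R) (k : Z) : floorZ (z + IZR k) = (floorZ z + k)%Z.
Proof. apply floorZ_unique; rewrite plus_IZR; generalize (floorZ_bounds z); lra. Qed.

Lemma gaussA0_gaussA (y : R) : gaussA0 y = 1 - gaussA y.
Proof.
unfold gaussA0, gaussA; rewrite (floorZ_plus_IZR _ 1), plus_IZR; ring.
Qed.

Lemma gaussA0_unit_irr (y : R) : unit_irr y -> unit_irr (gaussA0 y).
Proof. intros Hy; rewrite gaussA0_gaussA; apply unit_irr_1_minus, gaussA_unit_irr, Hy. Qed.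

Lemma gaussA_1_minus (x : R) : 0 < x < / 2 -> gaussA (1 - x) = x / (1 - x).
Proof.
intros Hx; unfold gaussA; rewrite (floorZ_unique _ 1); [field; lra |].
assert (H : 1 < / (1 - x)) by (rewrite <- Rinv_1; apply Rinv_lt_contravar; lra).
assert (H' : / (1 - x) < / / 2) by (apply Rinv_lt_contravar; lra).
rewrite Rinv_inv in H'; lra.
Qed.

(** (1 - x)/x = 1/x - 1: the Gauss orbits of x and 1 - x merge, the latter one step later. All the
    comparisons between x and 1 - x below for B and W rest on this. *)
Lemma gaussA_gaussA_1_minus (x : R) : 0 < x < / 2 ->
  gaussA (gaussA (1 - x)) = gaussA x.
Proof.
intros Hx; rewrite gaussA_1_minus by auto; unfold gaussA.
replace (/ (x / (1 - x))) with (/ x + IZR (-1)) by (field; lra).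
rewrite floorZ_plus_IZR, plus_IZR; ring.
Qed.

(** * The Brjuno and Wilton series under the reflection of x to 1 - x *)

Definition Bser (y : R) : R := Series (termB y).
Definition Wser (y : R) : R := Series (termW y).
Definition B0ser (y : R) : R := Series (termB0 y).

Lemma ex_series_term_S (A : R -> R) (y : R) : 0 < y ->
  ex_series (term A y) <-> ex_series (term A (A y)).
Proof.
intros Hy; rewrite ex_series_incr_1; split; intros H.
- apply ex_series_ext with (fun j => / y * term A y (S j)).
  { intros j; rewrite term_S, <- Rmult_assoc, Rinv_l, Rmult_1_l by lra; auto. }
  apply (ex_series_scal (/ y) (fun j => term A y (S j))); auto.
- apply ex_series_ext with (fun j => y * term A (A y) j).
  { intros j; rewrite term_S; auto. }
  apply (ex_series_scal y (term A (A y))); auto.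
Qed.

Lemma Series_term_S (A : R -> R) (y : R) : 0 < y -> ex_series (term A y) ->
  Series (term A y) = - ln y + y * Series (term A (A y)).
Proof.
intros Hy H; rewrite Series_incr_1, term_0 by auto; f_equal.
rewrite <- Series_scal_l; apply Series_ext; intros j; apply term_S.
Qed.

Lemma brj_gaussA (y : R) : brj y -> brj (gaussA y).
Proof.
intros [Hy H]; split; [apply gaussA_unit_irr; auto |].
apply (ex_series_term_S gaussA y); auto; apply Hy.
Qed.

Lemma Bser_S (y : R) : brj y -> Bser y = - ln y + y * Bser (gaussA y).
Proof. intros [Hy H]; apply (Series_term_S gaussA); auto; apply Hy. Qed.

Lemma brj_1_minus (y : R) : brj y -> brj (1 - y).
Proof.
assert (E : forall x, in_dom x -> ex_series (termB x) <-> ex_series (termB (1 - x))).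
{ intros x [Hx Hi].
  rewrite (ex_series_term_S gaussA x), (ex_series_term_S gaussA (1 - x)) by lra.
  rewrite (ex_series_term_S gaussA (gaussA (1 - x))).
  - rewrite gaussA_gaussA_1_minus by auto; tauto.
  - rewrite gaussA_1_minus by auto; apply Rdiv_lt_0_compat; lra. }
intros [Hy H]; split; [apply unit_irr_1_minus; auto |].
destruct (unit_irr_cases y Hy) as [Hx | (x & Hx & ->)]; [apply (E y Hx); auto |].
replace (1 - (1 - x)) with x by ring; apply (E x Hx); auto.
Qed.

Lemma brj_normZ (z : R) : brj z -> brj (normZ z).
Proof.
intros Hz; destruct (unit_irr_cases z (proj1 Hz)) as [[Hx _] | (x & [Hx _] & ->)].
- rewrite normZ_small by lra; auto.
- rewrite (normZ_refl x 1), normZ_small by lra.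
  replace x with (1 - (1 - x)) by ring; apply brj_1_minus; auto.
Qed.

Lemma termB_nonneg (y : R) (j : nat) : unit_irr y -> 0 <= termB y j.
Proof. apply (term_nonneg gaussA), gaussA_unit_irr. Qed.

Lemma Series_nonneg (a : nat -> R) : (forall j, 0 <= a j) -> ex_series a -> 0 <= Series a.
Proof.
intros Ha H; rewrite <- (Rmult_0_l (Series a)), <- Series_scal_l.
apply Series_le; auto; intros n; generalize (Ha n); lra.
Qed.

Lemma Bser_nonneg (y : R) : brj y -> 0 <= Bser y.
Proof. intros [Hy H]; apply Series_nonneg; auto; intros j; apply termB_nonneg; auto. Qed.

Lemma Bser_1_minus (x : R) : in_dom x -> brj (1 - x) ->
  Bser (1 - x) = - ln (1 - x) - (1 - x) * (ln x - ln (1 - x)) + x * Bser (gaussA x).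
Proof.
intros [Hx _] Hb; rewrite Bser_S, Bser_S by (auto; apply brj_gaussA; auto).
rewrite gaussA_gaussA_1_minus, gaussA_1_minus, ln_div by lra; field; lra.
Qed.

(** After the orbits merge both tails have weight x, since (1 - x) * x/(1 - x) = x. The difference
    B(1 - x) - B(x) is thus x ln(x/(1 - x)), which lies in [-1,0] for x < 1/2. *)
Lemma Bser_1_minus_le (z : R) : brj z -> Bser (1 - z) <= Bser z + 1.
Proof.
assert (E : forall x, in_dom x -> brj x ->
  Bser (1 - x) - Bser x = x * ln x - x * ln (1 - x)).
{ intros x Hx Hb; rewrite Bser_1_minus, (Bser_S x); auto; [ring | apply brj_1_minus; auto]. }
intros Hz; destruct (unit_irr_cases z (proj1 Hz)) as [Hx | (x & Hx & ->)].
- generalize (E z Hx Hz); destruct Hx as [Hx _].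
  generalize (xlnx_le_0 z ltac:(lra)) (xlnx_ge (1 - z) ltac:(lra)) (ln_le_0 (1 - z) ltac:(lra)).
  nra.
- apply brj_1_minus in Hz; replace (1 - (1 - x)) with x in * by ring.
  generalize (E x Hx Hz); destruct Hx as [Hx _].
  generalize (xlnx_ge x ltac:(lra)) (ln_le_0 (1 - x) ltac:(lra)); nra.
Qed.

Lemma ex_series_Rabs_termW (y : R) : brj y -> ex_series (fun j => Rabs (termW y j)).
Proof.
intros [Hy H]; apply ex_series_ext with (2 := H); intros j; unfold termW.
rewrite Rabs_mult, pow_1_abs, Rmult_1_l, Rabs_pos_eq; auto; apply termB_nonneg; auto.
Qed.

Lemma Wser_bound (y : R) : brj y -> Rabs (Wser y) <= Bser y.
Proof.
intros Hy; eapply Rle_trans; [apply Series_Rabs, ex_series_Rabs_termW; auto |].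
apply Req_le, Series_ext; intros j; unfold termW.
rewrite Rabs_mult, pow_1_abs, Rmult_1_l, Rabs_pos_eq; auto; apply termB_nonneg, Hy.
Qed.

Lemma Wser_S (y : R) : brj y -> Wser y = - ln y - y * Wser (gaussA y).
Proof.
intros Hy; unfold Wser; rewrite Series_incr_1 by (apply ex_series_Rabs, ex_series_Rabs_termW, Hy).
unfold termW at 1; change (termB y 0) with (term gaussA y 0).
rewrite term_0 by apply Hy; unfold Rminus; rewrite Ropp_mult_distr_l, <- Series_scal_l.
simpl pow; rewrite Rmult_1_l; f_equal; apply Series_ext; intros j; unfold termW.
change (termB y (S j)) with (term gaussA y (S j)); rewrite term_S; simpl.
change (term gaussA (gaussA y) j) with (termB (gaussA y) j); ring.
Qed.

(** The orbit of 1 - x reaches A(x) one step later than that of x, so the two tails have equal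
    weight and opposite signs and cancel; the remaining logarithms are 2 w. *)
Lemma Wser_even_part (z : R) : brj z -> Wser z + Wser (1 - z) = 2 * w z.
Proof.
assert (E : forall x, in_dom x -> brj x -> Wser x + Wser (1 - x) = 2 * w0 x).
{ intros x [Hx _] Hb; generalize (brj_1_minus x Hb); intros Hb'.
  rewrite (Wser_S x), (Wser_S (1 - x)), (Wser_S (gaussA (1 - x))) by (auto; apply brj_gaussA; auto).
  rewrite gaussA_gaussA_1_minus, gaussA_1_minus, ln_div by lra.
  unfold w0; rewrite ln_div by lra; field; lra. }
intros Hz; rewrite w_normZ.
destruct (unit_irr_cases z (proj1 Hz)) as [Hx | (x & Hx & ->)].
- rewrite normZ_small by (destruct Hx; lra); apply E; auto.
- rewrite (normZ_refl x 1), normZ_small by (destruct Hx; lra).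
  apply brj_1_minus in Hz; replace (1 - (1 - x)) with x in * by ring.
  rewrite <- E by auto; ring.
Qed.

(** Summation by parts: the weights 1 - ix decrease by x, which yields the sum of logarithms in
    [Phi]. [L O = 0] stands for ln 1. *)
Lemma sumR_abel (m : nat) (x : R) (L : nat -> R) : L O = 0 ->
  sumR (S m) (fun i => (1 - INR i * x) * (L i - L (S i))) =
  - x * sumR m (fun i => L (S i)) - (1 - INR m * x) * L (S m).
Proof.
intros HL; induction m as [| m IH]; [simpl; rewrite HL; ring |].
change (sumR (S m) (fun i => (1 - INR i * x) * (L i - L (S i))) +
  (1 - INR (S m) * x) * (L (S m) - L (S (S m))) =
  - x * (sumR m (fun i => L (S i)) + L (S m)) - (1 - INR (S m) * x) * L (S (S m))).
rewrite IH, S_INR; ring.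
Qed.

(* The orbit of [1 - x] under [gaussA0] is [(1 - (j+1) x) / (1 - j x)], until it joins
   the orbit of [gaussA x].  [F m] stands for the sum of the first [m] terms of the
   series [termB0], or for its total sum (then [F] does not depend on [m], and [P]
   is summability). *)
Lemma gaussA0_cocycle_1_minus (P : R -> Prop) (F : nat -> R -> R) (x : R) :
  (forall v, P v -> P (gaussA0 v)) ->
  (forall m v, P v -> F (S m) v = - ln v + v * F m (gaussA0 v)) ->
  in_dom x -> P (1 - x) -> P (gaussA x) -> forall m,
  F (Z.to_nat (floorZ (/ x)) + m)%nat (1 - x) = - Phi x + x * F (S m) (gaussA x).
Proof.
intros HP HF Hx HP1 HPA; assert (Hu := gaussA_unit_irr x (in_dom_unit_irr x Hx)).
destruct Hx as [Hx Hi].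
unfold Phi; destruct (floor_inv_nat x ltac:(lra)) as (n & -> & EA & Hn).
replace (S n - 1)%nat with n by lia.
assert (Hpos : 0 < 1 - INR (S n) * x) by (rewrite <- EA; destruct Hu; nra).
set (v := fun j => (1 - INR (S j) * x) / (1 - INR j * x)).
assert (Hj : forall j, (j <= S n)%nat -> 0 < 1 - INR j * x).
{ intros j Hj; apply le_INR in Hj; nra. }
assert (Hinv : forall j, (j <= n)%nat -> / v j = 1 + x / (1 - INR (S j) * x)).
{ intros j H; unfold v; generalize (Hj j ltac:(lia)) (Hj (S j) ltac:(lia)).
  rewrite S_INR; intros; field; split; lra. }
assert (Hstep : forall j, (j < n)%nat -> gaussA0 (v j) = v (S j)).
{ intros j H; unfold gaussA0; rewrite Hinv by lia.
  generalize (Hj (S j) ltac:(lia)) (Hj (S (S j)) ltac:(lia)); intros H1 H2.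
  (* 1/v_j = 1 + x/(1 - (j+1)x) lies strictly between 1 and 2. *)
  rewrite (floorZ_unique _ 2).
  - unfold v; rewrite (S_INR (S j)); field; lra.
  - rewrite (S_INR (S j)) in H2.
    assert (0 < x / (1 - INR (S j) * x) < 1); [| lra].
    split; [apply Rdiv_lt_0_compat; lra |].
    apply Rmult_lt_reg_r with (1 - INR (S j) * x); auto.
    unfold Rdiv; rewrite Rmult_assoc, Rinv_l; lra. }
assert (Hv : forall j, (j <= n)%nat -> P (v j)).
{ induction j as [| j IH]; intros H.
  - replace (v 0%nat) with (1 - x) by (unfold v; simpl; field); auto.
  - rewrite <- Hstep by lia; apply HP, IH; lia. }
assert (Hln : forall j, (j <= n)%nat ->
  ln (v j) = ln (1 - INR (S j) * x) - ln (1 - INR j * x)).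
{ intros j H; apply ln_div; apply Hj; lia. }
set (L := fun j => ln (1 - INR j * x)).
(* The product of the first j iterates telescopes to the weight 1 - jx. *)
assert (Hsum : forall j, (j <= n)%nat -> forall m, F (j + m)%nat (1 - x) =
  sumR j (fun i => (1 - INR i * x) * (L i - L (S i))) + (1 - INR j * x) * F m (v j)).
{ induction j as [| j IH]; intros H m.
  - replace (v 0%nat) with (1 - x) by (unfold v; simpl; field).
    simpl; ring.
  - replace (S j + m)%nat with (j + S m)%nat by lia; rewrite IH by lia.
    rewrite HF by (apply Hv; lia); rewrite Hstep, Hln by lia.
    change (sumR (S j) (fun i => (1 - INR i * x) * (L i - L (S i)))) with
      (sumR j (fun i => (1 - INR i * x) * (L i - L (S i))) + (1 - INR j * x) * (L j - L (S j))).
    unfold v at 1; fold (L j); fold (L (S j)).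
    generalize (Hj j ltac:(lia)); intros; field; lra. }
intros m; replace (S n + m)%nat with (n + S m)%nat by lia.
rewrite Hsum, HF by (auto; apply Hv; lia); rewrite Hln by lia.
(* Here the orbits merge: 1/v_n and 1/A(x) differ by 1, so both points have the same image. *)
assert (E0 : gaussA0 (v n) = gaussA0 (gaussA x)).
{ assert (Hinv' : / v n = / gaussA x + IZR 1).
  { rewrite Hinv, <- EA by lia; destruct Hu as [Hu _]; field; lra. }
  unfold gaussA0; rewrite Hinv', !(floorZ_plus_IZR _ 1), !plus_IZR; ring. }
rewrite E0, HF by auto.
generalize (sumR_abel n x L); change (L O) with (ln (1 - 0 * x)).
replace (1 - 0 * x) with 1 by ring; intros HL; specialize (HL ln_1).
change (sumR (S n) (fun i => (1 - INR i * x) * (L i - L (S i)))) with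
  (sumR n (fun i => (1 - INR i * x) * (L i - L (S i))) + (1 - INR n * x) * (L n - L (S n))) in HL.
fold (L n); fold (L (S n)).
assert (EL : L (S n) = ln x + ln (gaussA x)).
{ unfold L; rewrite <- EA; apply ln_mult; destruct Hu; lra. }
assert (En : 1 - INR n * x = x + x * gaussA x) by (rewrite EA, S_INR; ring).
replace (sumR n (fun i => (1 - INR i * x) * (L i - L (S i)))) with
  (- x * sumR n (fun i => L (S i)) - (1 - INR n * x) * L (S n)
   - (1 - INR n * x) * (L n - L (S n))) by lra.
replace (ln (x * gaussA x)) with (L (S n)) by (unfold L; rewrite EA; auto).
unfold v; rewrite <- EA, En, EL; unfold L.
field; destruct Hu; nra.
Qed.

(** * Convergence of the semi-Brjuno series *)

Definition B0part (m : nat) (y : R) : R := sumR m (termB0 y).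

Lemma sumR_S_head (n : nat) (g : nat -> R) : sumR (S n) g = g O + sumR n (fun k => g (S k)).
Proof.
induction n as [| n IH]; [simpl; ring |].
change (sumR (S n) g + g (S n) = g O + (sumR n (fun k => g (S k)) + g (S n))).
rewrite IH; ring.
Qed.

Lemma sumR_term_S (A : R -> R) (m : nat) (y : R) : 0 < y ->
  sumR (S m) (term A y) = - ln y + y * sumR m (term A (A y)).
Proof.
intros Hy; rewrite sumR_S_head, term_0, sumR_scal by auto; f_equal.
apply sumR_ext; intros j _; apply term_S.
Qed.

Lemma B0part_S (m : nat) (y : R) : unit_irr y ->
  B0part (S m) y = - ln y + y * B0part m (gaussA0 y).
Proof. intros Hy; apply (sumR_term_S gaussA0); apply Hy. Qed.

Lemma sumR_incr (m n : nat) (g : nat -> R) : (forall j, 0 <= g j) -> (m <= n)%nat ->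
  sumR m g <= sumR n g.
Proof.
intros Hg H; induction H as [| n H IH]; [lra |]; simpl; generalize (Hg n); lra.
Qed.

Lemma termB0_nonneg (y : R) (j : nat) : unit_irr y -> 0 <= termB0 y j.
Proof. apply (term_nonneg gaussA0), gaussA0_unit_irr. Qed.

Lemma floor_inv_ge_2 (x : R) : 0 < x < / 2 -> (2 <= Z.to_nat (floorZ (/ x)))%nat.
Proof.
intros Hx; assert (H : / / 2 < / x) by (apply Rinv_lt_contravar; nra).
rewrite Rinv_inv in H.
assert (floorZ 2 <= floorZ (/ x))%Z by (apply floorZ_le; lra).
rewrite (floorZ_unique 2 2) in H0 by lra; lia.
Qed.

Lemma gaussA_weighted_Bser_le (x : R) : in_dom x -> brj (1 - x) ->
  x * Bser (gaussA x) <= Bser (1 - x).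
Proof.
intros Hx Hb; rewrite Bser_1_minus by auto; destruct Hx as [Hx _].
assert (ln x <= ln (1 - x)) by (apply ln_le; lra).
generalize (ln_le_0 (1 - x) ltac:(lra)); nra.
Qed.

(** Above 1/2 the excursion costs -Phi <= 2 and leaves a weight x < 1/2, so the constant must
    satisfy 2 + c/2 <= c; c = 4 also absorbs the reflection cost below 1/2. The induction is strong
    on the number of terms, since an excursion is crossed in one go. *)
Lemma B0part_bound (m : nat) (z : R) : brj z -> B0part m z <= 4 + 2 * Bser z.
Proof.
revert z; induction m as [m IH] using lt_wf_ind; intros z Hz.
destruct (unit_irr_cases z (proj1 Hz)) as [Hx | (x & Hx & ->)].
- destruct m as [| m]; [unfold B0part; simpl; generalize (Bser_nonneg z Hz); lra |].
  rewrite B0part_S, gaussA0_gaussA by apply Hz.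
  assert (Hg := brj_gaussA z Hz).
  generalize (IH m (Nat.lt_succ_diag_r m) _ (brj_1_minus _ Hg)) (Bser_1_minus_le _ Hg) (Bser_S z Hz).
  destruct Hx as [Hx _]; generalize (ln_le_0 z ltac:(lra)); nra.
(* Adding nonnegative terms makes the count a full excursion plus a remainder, as floor(1/x) >= 2.
   For m >= 2 this leaves m - 1 terms at A(x), fewer than m. *)
- assert (Hm : B0part m (1 - x) <= B0part (Z.to_nat (floorZ (/ x)) + (m - 2)) (1 - x)).
  { apply sumR_incr; [intros j; apply termB0_nonneg, Hz |].
    generalize (floor_inv_ge_2 x (proj1 Hx)); lia. }
  assert (Hb : brj x).
  { replace x with (1 - (1 - x)) by ring; apply brj_1_minus; auto. }
  destruct (Nat.le_gt_cases 2 m) as [H2 | H2].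
  + rewrite (gaussA0_cocycle_1_minus unit_irr B0part) in Hm
      by (auto using gaussA0_unit_irr, gaussA_unit_irr, in_dom_unit_irr, unit_irr_1_minus, B0part_S).
    generalize (IH (S (m - 2)) ltac:(lia) _ (brj_gaussA x Hb)) (gaussA_weighted_Bser_le x Hx Hz).
    destruct Hx as [Hx _]; generalize (Phi_ge x ltac:(lra)); nra.
  + clear Hm; apply Rle_trans with (B0part 1 (1 - x)).
    * apply sumR_incr; [intros j; apply termB0_nonneg, Hz | lia].
    * rewrite B0part_S by apply Hz; unfold B0part; simpl sumR.
      generalize (Bser_nonneg _ Hz) (xlnx_ge (1 - x)); destruct Hx as [Hx _].
      intros H H'; specialize (H' ltac:(lra)); nra.
Qed.

Lemma sum_n_sumR (a : nat -> R) (n : nat) : sum_n a n = sumR (S n) a.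
Proof.
induction n as [| n IH]; [rewrite sum_O; simpl; ring |].
rewrite sum_Sn, IH; reflexivity.
Qed.

Lemma ex_series_nonneg_bounded (a : nat -> R) (M : R) : (forall j, 0 <= a j) ->
  (forall n, sumR n a <= M) -> ex_series a /\ Series a <= M.
Proof.
intros Ha HM; destruct (ex_finite_lim_seq_incr (sum_n a) M) as [l Hl].
- intros n; rewrite !sum_n_sumR; apply sumR_incr; auto.
- intros n; rewrite sum_n_sumR; auto.
- assert (Hs : is_series a l) by apply Hl.
  split; [exists l; auto |]; rewrite (is_series_unique _ _ Hs).
  apply (is_lim_seq_le (sum_n a) (fun _ => M) l M); auto; [| apply is_lim_seq_const].
  intros n; rewrite sum_n_sumR; auto.
Qed.

Lemma B0ser_spec (z : R) : brj z -> ex_series (termB0 z) /\ 0 <= B0ser z <= 4 + 2 * Bser z.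
Proof.
intros Hz; assert (Hn : forall j, 0 <= termB0 z j) by (intros j; apply termB0_nonneg, Hz).
destruct (ex_series_nonneg_bounded (termB0 z) (4 + 2 * Bser z)) as [H1 H2]; auto.
{ intros n; apply (B0part_bound n z Hz). }
split; auto; split; auto; apply Series_nonneg; auto.
Qed.

(** * Functional equation of [Delta_minus] and comparison with the partial sums *)

Definition Dser (y : R) : R :=
  / 2 * (Wser y - Wser (1 - y)) - (B0ser y - B0ser (1 - y)).

Lemma fracR_opp (z : R) : irrationalR z -> fracR (- z) = 1 - fracR z.
Proof.
intros Hz; generalize (fracR_unit_irr z Hz) (fracR_plus_floor z); intros [Hf _] E.
unfold fracR at 1; rewrite (floorZ_unique (- z) (- floorZ z - 1)).
- rewrite minus_IZR, opp_IZR; lra.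
- rewrite minus_IZR, opp_IZR; lra.
Qed.

Lemma fracR_unit (y : R) : 0 <= y < 1 -> fracR y = y.
Proof. intros H; unfold fracR; rewrite (floorZ_unique y 0) by lra; ring. Qed.

Lemma Delta_minus_Dser (x : R) : unit_irr x -> Delta_minus x = Dser x.
Proof.
intros [Hx Hi]; unfold Delta_minus, WiltonW, BrjunoB0.
rewrite fracR_opp, fracR_unit by (auto; lra); reflexivity.
Qed.

Lemma Dser_bound (z : R) : brj z -> Rabs (Dser z) <= 11 + 5 * Bser z.
Proof.
intros Hz; assert (Hz' := brj_1_minus z Hz).
generalize (Wser_bound z Hz) (Wser_bound _ Hz') (B0ser_spec z Hz) (B0ser_spec _ Hz')
  (Bser_1_minus_le z Hz); intros H1 H2 [_ H3] [_ H4] H5.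
apply Rabs_le_between in H1; apply Rabs_le_between in H2.
unfold Dser; apply Rabs_le; split; lra.
Qed.

Lemma Dser_oddper (z : R) : unit_irr z -> oddper Dser z = Dser z.
Proof.
intros [Hz Hi]; rewrite oddper_fracR, fracR_unit by (auto; lra).
destruct Rlt_dec; auto; unfold Dser.
replace (1 - (1 - z)) with z by ring; ring.
Qed.

Lemma oddper_gaussA (g : R -> R) (x : R) : oddper g (gaussA x) = oddper g (/ x).
Proof.
unfold gaussA; rewrite <- (oddper_plus_IZR g _ (floorZ (/ x))); f_equal; ring.
Qed.

Lemma B0ser_S (y : R) : brj y -> B0ser y = - ln y + y * B0ser (gaussA0 y).
Proof. intros Hy; apply (Series_term_S gaussA0); [apply Hy | apply (B0ser_spec y Hy)]. Qed.

Lemma B0ser_1_minus (x : R) : in_dom x -> brj x ->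
  B0ser (1 - x) = - Phi x + x * B0ser (gaussA x).
Proof.
intros Hx Hb.
assert (HS : forall z, brj z -> unit_irr z /\ ex_series (termB0 z)).
{ intros z Hz; split; [apply Hz | apply (B0ser_spec z Hz)]. }
refine (gaussA0_cocycle_1_minus (fun v => unit_irr v /\ ex_series (termB0 v))
  (fun _ => B0ser) x _ _ Hx _ _ O).
- intros v [Hv Hs]; split; [apply gaussA0_unit_irr; auto |].
  apply (ex_series_term_S gaussA0 v); auto; apply Hv.
- intros _ v [Hv Hs]; apply (Series_term_S gaussA0); auto; apply Hv.
- apply HS, brj_1_minus; auto.
- apply HS, brj_gaussA; auto.
Qed.

(** Eliminating W(1 - x) through the even part turns [Dser x] into W(x) - w(x) - B_0(x) + B_0(1 -
    x). The terms -ln x of W and B_0 cancel, and [B0ser_1_minus] supplies [Phi]. *)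
Lemma Dser_functional_equation (x : R) : in_dom x -> brj x ->
  Dser x = Defs.f x - x * Dser (gaussA x).
Proof.
intros Hx Hb; assert (Hg := brj_gaussA x Hb); unfold Dser, Defs.f.
generalize (Wser_even_part x Hb) (Wser_even_part _ Hg); intros H1 H2.
replace (Wser (1 - x)) with (2 * w x - Wser x) by lra.
replace (Wser (1 - gaussA x)) with (2 * w (gaussA x) - Wser (gaussA x)) by lra.
rewrite B0ser_1_minus, (B0ser_S x), (Wser_S x), gaussA0_gaussA by auto; field.
Qed.

Definition tailB (M : nat) (z : R) : R := Bser z - sumR M (termB z).

Lemma tailB_S (M : nat) (z : R) : brj z -> tailB (S M) z = z * tailB M (gaussA z).
Proof.
intros Hz; unfold tailB; rewrite Bser_S by auto.
change (termB z) with (term gaussA z); rewrite sumR_term_S by apply Hz.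
change (term gaussA (gaussA z)) with (termB (gaussA z)); ring.
Qed.

Lemma tailB_decr (M : nat) (z : R) : brj z -> tailB (S M) z <= tailB M z.
Proof.
intros Hz; unfold tailB; simpl sumR; generalize (termB_nonneg z M (proj1 Hz)); lra.
Qed.

(* [gaussA (normZ z)] is [gaussA z] for [z < 1/2], and [gaussA (gaussA z)] for [z > 1/2]. *)
Lemma tailB_normZ (M : nat) (z : R) : brj z ->
  normZ z * tailB M (gaussA (normZ z)) <= tailB (S M) z.
Proof.
intros Hz; destruct (unit_irr_cases z (proj1 Hz)) as [[Hx _] | (x & [Hx _] & ->)].
- rewrite normZ_small, tailB_S by (auto; lra); lra.
- rewrite (normZ_refl x 1), normZ_small by lra.
  apply Rle_trans with (2 := tailB_decr (S M) _ Hz).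
  rewrite tailB_S, tailB_S by (auto; apply brj_gaussA; auto).
  rewrite gaussA_gaussA_1_minus, gaussA_1_minus by auto.
  apply Req_le; field; lra.
Qed.

(** Stated at [normZ z] for z in (0,1), because the induction passes to A(x), which may exceed 1/2,
    while the recursion sees only its distance to the integers. The constants come from
    [Dser_bound]; each factor x < 1/2 halves the first term and is absorbed by the tail in the
    second. *)
Lemma Dser_DeltaM_dist (M : nat) (z : R) : brj z ->
  Rabs (Dser (normZ z) - DeltaM M (normZ z)) <= 11 * (/ 2) ^ M + 5 * tailB M z.
Proof.
revert z; induction M as [| M IH]; intros z Hz; generalize (tailB_normZ 0 z Hz);
  generalize (normZ_in_dom z (proj2 (proj1 Hz))) (brj_normZ z Hz); set (x := normZ z);
  intros Hx Hb; assert (Hg := brj_gaussA x Hb).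
- intros Ht; generalize (tailB_decr 0 z Hz); intros Hd.
  rewrite DeltaM_0, Dser_functional_equation by auto.
  replace (_ - _) with (- (x * Dser (gaussA x))) by ring.
  destruct Hx as [Hx _]; rewrite Rabs_Ropp, Rabs_mult, Rabs_pos_eq by lra.
  generalize (Dser_bound _ Hg); intros HD.
  replace (tailB 0 (gaussA x)) with (Bser (gaussA x)) in Ht by (unfold tailB; simpl; ring).
  simpl pow; nra.
- intros _; generalize (tailB_normZ M z Hz) (IH _ Hg); fold x; intros Ht HD.
  rewrite DeltaM_S, Dser_functional_equation by auto.
  rewrite <- (Dser_oddper (gaussA x)) by apply Hg; rewrite oddper_gaussA.
  rewrite normZ_gaussA in HD.
  unfold oddper; replace (_ - _) with
    (- (x * sgnZ (/ x) * (Dser (normZ (/ x)) - DeltaM M (normZ (/ x))))) by ring.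
  destruct Hx as [Hx _]; rewrite Rabs_Ropp, !Rabs_mult, Rabs_sgnZ, (Rabs_pos_eq x) by lra.
  generalize (half_pow_pos M); simpl pow; nra.
Qed.

Lemma is_lim_seq_tailB (z : R) : brj z -> is_lim_seq (fun M => tailB M z) 0.
Proof.
intros [Hz Hs]; apply is_lim_seq_incr_1.
replace (Finite 0) with (Finite (Bser z - Bser z)) by (f_equal; ring).
apply is_lim_seq_ext with (fun n => Bser z - sum_n (termB z) n).
{ intros n; unfold tailB; rewrite sum_n_sumR; auto. }
apply (is_lim_seq_minus' (fun _ => Bser z)); [apply is_lim_seq_const |].
apply (Series_correct _ Hs).
Qed.

Lemma is_series_Delta_minus (x : R) : 0 < x < / 2 -> Brjuno x ->
  is_series (Dterm x) (Delta_minus x).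
Proof.
intros Hx [Hi Hs]; rewrite fracR_unit in Hs by lra.
assert (Hb : brj x) by (split; auto; split; auto; lra).
rewrite Delta_minus_Dser by apply Hb.
assert (H : is_lim_seq (fun n => 11 * (/ 2) ^ n + 5 * tailB n x) 0).
{ replace (Finite 0) with (Finite (11 * 0 + 5 * 0)) by (f_equal; ring).
  apply is_lim_seq_plus'; apply (is_lim_seq_scal_l _ _ (Finite 0)).
  - apply is_lim_seq_geom; rewrite Rabs_pos_eq; lra.
  - apply is_lim_seq_tailB; auto. }
change (is_lim_seq (sum_n (Dterm x)) (Dser x)).
apply is_lim_seq_ext with (fun n => Dser x - (Dser x - DeltaM n x)).
{ intros n; rewrite sum_n_Reals; unfold DeltaM; ring. }
replace (Finite (Dser x)) with (Finite (Dser x - 0)) by (f_equal; ring).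
apply is_lim_seq_minus'; [apply is_lim_seq_const |].
apply is_lim_seq_abs_0; apply is_lim_seq_le_le with (3 := H) (u := fun _ => 0);
  [| apply is_lim_seq_const].
intros n; split; [apply Rabs_pos |].
generalize (Dser_DeltaM_dist n x Hb); rewrite normZ_small by lra; auto.
Qed.

Theorem mainTheorem7 :
  (* (i) *)
  (forall x : R, 0 < x < / 2 -> Brjuno x ->
     is_series (Dterm x) (Delta_minus x))
  /\
  (* (ii) uniform convergence on (0,1/2) \ Q *)
  (exists g : R -> R, forall eps : R, 0 < eps ->
     exists N : nat, forall n : nat, (N <= n)%nat ->
       forall x : R, in_dom x -> Rabs (DeltaM n x - g x) < eps)
  /\
  (* (iii) *)
  (forall M : nat, (1 <= M)%nat ->
     (* continuity on (0,1/2) \ Q *)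
     (forall x : R, in_dom x ->
        forall eps : R, 0 < eps -> exists delta : R, 0 < delta /\
          forall y : R, in_dom y -> Rabs (y - x) < delta ->
            Rabs (DeltaM M y - DeltaM M x) < eps)
     /\
     (* limit at rationals of depth > M *)
     (forall r : R, 0 < r < / 2 -> rationalR r ->
        (exists d : nat, is_depth r d /\ (M < d)%nat) ->
        exists L : R, forall eps : R, 0 < eps -> exists delta : R, 0 < delta /\
          forall y : R, in_dom y -> 0 < Rabs (y - r) < delta ->
            Rabs (DeltaM M y - L) < eps)
     /\
     (* jump 2/q at rationals p/q of depth <= M *)
     (forall p q : Z, (0 < q)%Z -> Z.gcd p q = 1%Z ->
        0 < IZR p / IZR q < / 2 ->
        (exists d : nat, is_depth (IZR p / IZR q) d /\ (d <= M)%nat) ->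
        exists Lp Lm : R,
          (forall eps : R, 0 < eps -> exists delta : R, 0 < delta /\
             forall y : R, in_dom y -> IZR p / IZR q < y < IZR p / IZR q + delta ->
               Rabs (DeltaM M y - Lp) < eps)
          /\
          (forall eps : R, 0 < eps -> exists delta : R, 0 < delta /\
             forall y : R, in_dom y -> IZR p / IZR q - delta < y < IZR p / IZR q ->
               Rabs (DeltaM M y - Lm) < eps)
          /\ Lp - Lm = 2 / IZR q)).
Proof.
split; [exact is_series_Delta_minus | split; [exact DeltaM_uniform |]].
intros M _; split; [exact (DeltaM_continuous M) | split].
- exact (DeltaM_limit_rational M).
- exact (DeltaM_jump_rational M).
Qed.
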